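(* Let $\mathfrak{g}$ be an $n$-dimensional filiform Lie algebra over an algebraically closed field $k$ of characteristic zero. Then: (1) If $\mathfrak{g}$ is of type $Q_n$ or $W_n$, then $i(\mathfrak{g})\leq 2$, so $\mathfrak{g}$ is coregular. (2) If $\mathfrak{g}$ is of type $L_n$ or $R_n$, then $\mathfrak{g}$ is coregular if and only if $i(\mathfrak{g})\leq 2$.
   Context: With $C^1(\mathfrak{g})=\mathfrak{g}$ and $C^i(\mathfrak{g})=[\mathfrak{g},C^{i-1}(\mathfrak{g})]$, an $n$-dimensional Lie algebra $\mathfrak{g}$ is filiform if $\dim C^i(\mathfrak{g})=n-i$ for $i=2,\ldots,n$. Types (each with basis $x_1,\ldots,x_n$; only nonzero brackets, up to antisymmetry, are listed): - $Q_n$, $n=2q$ even: $[x_1,x_i]=x_{i+1}$ for $i=2,\ldots,n-2$, and $[x_j,x_{n-j+1}]=(-1)^{j+1}x_n$ for $j=2,\ldots,q$. - $W_n$: $[x_i,x_j]=(j-i)x_{i+j}$ for $i<j$ and $i+j\leq n$. - $L_n$, $n\geq3$: $[x_1,x_i]=x_{i+1}$ for $i=2,\ldots,n-1$. - $R_n$, $n\geq5$: $[x_1,x_i]=x_{i+1}$ for $i=2,\ldots,n-1$, and $[x_2,x_j]=x_{j+2}$ for $j=3,\ldots,n-2$. The index is $i(\mathfrak{g})=\min_{\xi\in\mathfrak{g}^*}\dim\{x\in\mathfrak{g}\mid\xi([x,y])=0\ \forall y\in\mathfrak{g}\}$. $\mathfrak{g}$ is coregular if $Y(\mathfrak{g})=S(\mathfrak{g})^{\mathfrak{g}}$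 (invariants of the adjoint action on the symmetric algebra) is a polynomial algebra over $k$. *)

(* Defs.v *)
From HB Require Import structures.
From mathcomp Require Import all_boot all_order all_algebra.
From mathcomp Require Import boolp.
From mathcomp Require Import mpoly.

Set Implicit Arguments.
Unset Strict Implicit.
Unset Printing Implicit Defensive.

Import GRing.Theory.
Local Open Scope ring_scope.

HB.mixin Record Vector_isLieAlgebra (k : fieldType) (g : Type) of Vector k g := {
  lieb : g -> g -> g;
  lieb_linearl : forall (a : k) (x y z : g),
    lieb (a *: x + y) z = a *: lieb x z + lieb y z;
  lieb_linearr : forall (a : k) (x y z : g),
    lieb x (a *: y + z) = a *: lieb x y + lieb x z;
  liebb : forall x : g, lieb x x = 0;
  lieb_jacobi : forall x y z : g,
    lieb x (lieb y z) + lieb y (lieb z x) + lieb z (lieb x y) = 0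
}.

#[short(type="lieAlgType")]
HB.structure Definition LieAlgebra (k : fieldType) :=
  { g of Vector k g & Vector_isLieAlgebra k g }.

Section LieAlgebraDefs.
Variables (k : fieldType) (g : lieAlgType k).
Implicit Types (x y : g) (U W X : {vspace g}) (xi : 'Hom(g, k^o)).

Fact lieb_is_linearr x : linear (lieb x).
Proof. by move=> a y z; exact: lieb_linearr. Qed.

Fact lieb_is_linearl y : linear (lieb^~ y).
Proof. by move=> a x z; exact: lieb_linearl. Qed.

HB.instance Definition _ x :=
  GRing.isLinear.Build k g g _ (lieb x) (lieb_is_linearr x).

(* The subspace [U, W] spanned by all brackets; by bilinearity, brackets of
   basis vectors suffice (see lie_commvP). *)
Definition lie_commv U W : {vspace g} :=
  <<[seq lieb u w | u <- vbasis U, w <- vbasis W]>>%VS.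

Lemma lie_commvP U W X :
  reflect (forall u w, u \in U -> w \in W -> lieb u w \in X)
          (lie_commv U W <= X)%VS.
Proof.
apply: (iffP span_subvP) => [sX u w uU wW | sX _ /allpairsP[[u w] /= [uU wW ->]]].
  rewrite (coord_vbasis uU) (coord_vbasis wW).
  have -> v : lieb (\sum_i coord (vbasis U) i u *: (vbasis U)`_i) v
     = \sum_i coord (vbasis U) i u *: lieb (vbasis U)`_i v.
    pose lv := GRing.isLinear.Build k g g _ (lieb^~ v) (lieb_is_linearl v).
    pose L : {linear g -> g} := HB.pack (lieb^~ v) lv.
    rewrite -[LHS]/(L _) linear_sum; apply: eq_bigr => i _.
    by rewrite linearZ.
  apply: memv_suml => i _; apply: memvZ; rewrite linear_sum.
  apply: memv_suml => j _; rewrite linearZ; apply: memvZ.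
  apply: sX; apply/allpairsP; exists ((vbasis U)`_i, (vbasis W)`_j).
  by rewrite !mem_nth ?size_tuple.
by apply: sX; apply: vbasis_mem.
Qed.

(* lcs 1 = g and lcs i = [g, lcs (i - 1)]; lcs 0 = g is a junk value. *)
Definition lcs (i : nat) : {vspace g} := iter i.-1 (lie_commv fullv) fullv.

Definition filiform : Prop :=
  forall i : nat, (2 <= i <= \dim {:g})%N -> \dim (lcs i) = (\dim {:g} - i)%N.

Definition lie_radical xi : {vspace g} :=
  lker (linfun (fun x => linfun (fun y => xi (lieb x y)) : 'Hom(g, k^o))).

Lemma mem_lie_radical xi x :
  x \in lie_radical xi <-> forall y, xi (lieb x y) = 0.
Proof.
have lin_y z : linear (fun y => xi (lieb z y) : k^o).
  by move=> a u v; rewrite lieb_linearr linearP.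
have evE z y : linfun (fun y => xi (lieb z y) : k^o) y = xi (lieb z y).
  pose L : {linear g -> k^o} := HB.pack (fun y => xi (lieb z y) : k^o)
    (GRing.isLinear.Build k g k^o _ _ (lin_y z)).
  by rewrite -[RHS]/(L y) -(lfunE L).
have lin_x : linear (fun z => linfun (fun y => xi (lieb z y) : k^o)).
  move=> a u v; apply/lfunP => y.
  by rewrite add_lfunE scale_lfunE !evE lieb_linearl linearP.
pose M : {linear g -> 'Hom(g, k^o)} := HB.pack
  (fun z => linfun (fun y => xi (lieb z y) : k^o))
  (GRing.isLinear.Build k g _ _ _ lin_x).
rewrite memv_ker -[linfun _]/(linfun M) lfunE /=; split=> [/eqP e y | e].
  by rewrite -evE e lfunE.
by apply/eqP/lfunP => y; rewrite evE e lfunE.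
Qed.

Fact lie_index_subproof :
  exists d : nat, `[< exists xi, \dim (lie_radical xi) = d >].
Proof. by exists (\dim (lie_radical 0)); apply/asboolP; exists 0. Qed.

Definition lie_index : nat := ex_minn lie_index_subproof.

(* S(g) is modelled as the polynomial ring whose variables 'X_i are the vectors
   e_i of the basis vbasis {:g}; symalg_univ is its universal property. *)
Definition symalg := {mpoly k[\dim {:g}]}.

Definition symalg_in x : symalg :=
  \sum_(i < \dim {:g}) coord (vbasis {:g}) i x *: 'X_i.

(* The unique derivation of S(g) extending ad x. *)
Definition symalg_ad x (p : symalg) : symalg :=
  \sum_(i < \dim {:g}) p^`M(i) * symalg_in (lieb x (vbasis {:g})`_i).

Fact symalg_in_is_linear : linear symalg_in.
Proof.
move=> a x y; rewrite /symalg_in scaler_sumr -big_split; apply: eq_bigr => i _.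
by rewrite linearP /= scalerDl scalerA.
Qed.

HB.instance Definition _ :=
  GRing.isLinear.Build k g symalg _ symalg_in symalg_in_is_linear.

Lemma symalg_in_basis (i : 'I_(\dim {:g})) : symalg_in (vbasis {:g})`_i = 'X_i.
Proof.
rewrite /symalg_in (bigD1 i) //= big1 => [|j ne_ji].
  by rewrite coord_free ?(basis_free (vbasisP _)) // eqxx scale1r addr0.
by rewrite coord_free ?(basis_free (vbasisP _)) // eq_sym (negPf ne_ji) scale0r.
Qed.

Lemma symalg_univ (A : comAlgType k) (f : {linear g -> A}) :
  (exists phi : {lrmorphism symalg -> A}, forall x, phi (symalg_in x) = f x) /\
  (forall phi psi : {lrmorphism symalg -> A},
     (forall x, phi (symalg_in x) = psi (symalg_in x)) -> phi =1 psi).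
Proof.
split; last first.
  move=> phi psi eq_in p; rewrite [p]mpolyE !linear_sum; apply: eq_bigr => m _.
  rewrite !linearZ /=; congr (_ *: _).
  rewrite mpolyXE_id !rmorph_prod; apply: eq_bigr => i _.
  by rewrite !rmorphXn /= -symalg_in_basis eq_in.
pose h (i : 'I_(\dim {:g})) := f (vbasis {:g})`_i.
pose ev := mmap (in_alg A) h : symalg -> A.
have cf p i j : GRing.comm (in_alg A p) (h i) by move=> *; exact: mulrC.
have lin : linear ev.
  move=> a p q; rewrite /ev raddfD /= -mul_mpolyC rmorphM /= mmapC.
  by rewrite /= mulr_algl.
have mul : monoid_morphism ev by split=> [|p q]; rewrite /ev ?rmorph1 ?rmorphM.
pose phi : {lrmorphism symalg -> A} := HB.pack ev
  (GRing.isLinear.Build k symalg A _ ev lin)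
  (GRing.isMonoidMorphism.Build symalg A ev mul).
exists phi => x; rewrite /symalg_in linear_sum.
rewrite {2}(coord_vbasis (memvf x)) linear_sum; apply: eq_bigr => i _.
by rewrite !linearZ /= /ev mmapX mmap1U.
Qed.

Fact symalg_ad_is_linear x : linear (symalg_ad x).
Proof.
move=> a p q; rewrite /symalg_ad scaler_sumr -big_split; apply: eq_bigr => i _.
by rewrite /= linearP mulrDl -scalerAl.
Qed.

HB.instance Definition _ x :=
  GRing.isLinear.Build k symalg symalg _ (symalg_ad x) (symalg_ad_is_linear x).

Lemma symalg_ad_in x y : symalg_ad x (symalg_in y) = symalg_in (lieb x y).
Proof.
rewrite {1}/symalg_in linear_sum {2}(coord_vbasis (memvf y)) !linear_sum.
apply: eq_bigr => i _; rewrite !linearZ /=; congr (_ *: _).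
rewrite /symalg_ad (bigD1 i) //= big1 => [|j ne_ji]; last first.
  by rewrite mderivX mnm1E eq_sym (negPf ne_ji) scale0r mul0r.
rewrite mderivX mnm1E eqxx scale1r addr0 (_ : (_ - _)%MM = 0%MM).
  by rewrite mpolyX0 mul1r.
by apply/mnmP => j; rewrite mnmBE mnm0E subnn.
Qed.

Lemma symalg_adM x p q :
  symalg_ad x (p * q) = symalg_ad x p * q + p * symalg_ad x q.
Proof.
rewrite /symalg_ad mulr_suml mulr_sumr -big_split; apply: eq_bigr => i _ /=.
by rewrite mderivM mulrDl mulrA [X in X + _]mulrAC.
Qed.

Definition sym_invariant (p : symalg) : Prop := forall x, symalg_ad x p = 0.

(* Y(g) is isomorphic to some k[T_1, ..., T_m] as a k-algebra; the isomorphism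
   is given as an injective algebra morphism to S(g) with image Y(g). *)
Definition coregular : Prop :=
  exists (m : nat) (phi : {lrmorphism {mpoly k[m]} -> symalg}),
    injective phi /\
    forall p : symalg, sym_invariant p <-> exists q : {mpoly k[m]}, phi q = p.

(* x_1, ..., x_n is a basis with [x_i, x_j] = T x i j for 1 <= i < j <= n; the
   other brackets are determined by antisymmetry. *)
Definition lie_table n (T : (nat -> g) -> nat -> nat -> g) : Prop :=
  exists X : n.-tuple g,
    let x i := X`_i.-1 in
    basis_of {:g} X /\
    forall i j : nat, (1 <= i)%N -> (i < j)%N -> (j <= n)%N ->
      lieb (x i) (x j) = T x i j.

Definition typeQ n : Prop :=
  ~~ odd n /\
  lie_table n (fun (x : nat -> g) i j =>
    if (i == 1)%N && (2 <= j <= n - 2)%N then x j.+1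
    else if (2 <= i <= n./2)%N && (j == n - i + 1)%N then (-1) ^+ i.+1 *: x n
    else 0).

Definition typeW n : Prop :=
  lie_table n (fun (x : nat -> g) i j =>
    if (i + j <= n)%N then (j - i)%N%:R *: x (i + j)%N else 0).

Definition typeL n : Prop :=
  (3 <= n)%N /\
  lie_table n (fun (x : nat -> g) i j =>
    if (i == 1)%N && (2 <= j <= n - 1)%N then x j.+1 else 0).

Definition typeR n : Prop :=
  (5 <= n)%N /\
  lie_table n (fun (x : nat -> g) i j =>
    if (i == 1)%N && (2 <= j <= n - 1)%N then x j.+1
    else if (i == 2)%N && (3 <= j <= n - 2)%N then x j.+2
    else 0).

End LieAlgebraDefs.

(* Main.v *)
From HB Require Import structures.
Require Import Defs.
From mathcomp Require Import all_boot all_order all_algebra.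
From mathcomp Require Import mpoly.
From mathcomp Require Import boolp ring zify.

Set Implicit Arguments.
Unset Strict Implicit.
Unset Printing Implicit Defensive.

Import GRing.Theory.
Local Open Scope ring_scope.

(** Polynomiality. In all the cases of index at most 2, the basis can be given
    weights such that the bracket is graded, and the form [x_n^*([., .])] pairs
    all basis vectors other than [x_n] and one [x_u]. This pairing makes the
    gradient of an invariant [p] a multiple of [dp/dx_u], up to a power of the
    central element [z = x_n]. Euler's identity then reads
    [H * dp/dx_u = wt(p) * z^T * p] with [H] linear in [x_u] and independent
    of [p], and solving this equation gives [p = f^m * q(z)], where [f] is [H]
    without its factors [z]. Hence the invariants form [k[z, f]] if [f] is
    invariant, and [k[z]] if not.

    Non-polynomiality. Put [y_i = x_(n-i)]. For [L_n], [n >= 5], there are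
    invariants [f_2], [f_3] which restrict to [t^2], [t^3] on the [y_1]-axis
    and satisfy [f_3^2 = f_2^3 + y_0^2 G]. No invariant has a term linear in
    [y_1], so the coefficient of [y_1^2] is a derivation at the origin on the
    invariants. If they formed a polynomial ring, there would be a line in the
    direction of this tangent vector; along it [y_0] and [f_3] vanish to order
    2 but [f_2] only to order 1, which contradicts the relation. For [R_n],
    [n >= 7], the same works with the coefficient of [y_1^3] and a relation
    [f_4^3 = - f_3^4 + y_0^3 G]. *)

(** * Derivations of multivariate polynomial rings *)

Lemma mpoly_gen_ind (R : fieldType) n (P : {mpoly R[n]} -> Prop) :
  (forall c, P c%:MP) -> (forall i, P 'X_i) ->
  (forall p q, P p -> P q -> P (p + q)) ->
  (forall p q, P p -> P q -> P (p * q)) -> forall p, P p.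
Proof.
move=> PC PX PD PM p; rewrite [p]mpolyE.
apply: big_ind => [||m _]; [by rewrite -mpolyC0; apply: PC | exact: PD |].
rewrite -mul_mpolyC; apply: (PM _ _ (PC _)); rewrite mpolyXE_id.
apply: big_ind => [||i _]; [by rewrite -mpolyC1; apply: PC | exact: PM |].
elim: (m i) => [|j IHj]; first by rewrite expr0 -mpolyC1; apply: PC.
by rewrite exprS; apply: PM.
Qed.

Lemma mderivXU (R : fieldType) n (i j : 'I_n) :
  'X_i^`M(j) = (i == j)%:R :> {mpoly R[n]}.
Proof.
rewrite mderivX mnm1E; case: eqVneq => [->|_]; last by rewrite scale0r.
rewrite scale1r (_ : (_ - _)%MM = 0%MM) ?mpolyX0 //.
by apply/mnmP => l; rewrite mnmBE mnm0E subnn.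
Qed.

Section Derivation.
Variables (R : fieldType) (d : nat).
Implicit Types (v : 'I_d -> {mpoly R[d]}) (p q : {mpoly R[d]}).

(** The body is that of [symalg_ad] with arbitrary values [v], so lemmas on [mder] apply to
    [symalg_ad] by conversion. *)
Definition mder v p : {mpoly R[d]} := \sum_(j < d) p^`M(j) * v j.

Fact mder_is_linear v : linear (mder v).
Proof.
move=> a p q; rewrite /mder scaler_sumr -big_split; apply: eq_bigr => i _.
by rewrite /= linearP mulrDl -scalerAl.
Qed.
HB.instance Definition _ v :=
  GRing.isLinear.Build R {mpoly R[d]} {mpoly R[d]} _ (mder v) (mder_is_linear v).

Lemma mderX v i : mder v 'X_i = v i.
Proof.
rewrite /mder (bigD1 i) //= mderivXU eqxx mul1r big1 ?addr0 // => j ne_ji.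
by rewrite mderivXU eq_sym (negPf ne_ji) mul0r.
Qed.

Lemma mderC v c : mder v c%:MP = 0.
Proof. by rewrite /mder big1 // => i _; rewrite mderivC mul0r. Qed.

Lemma mderM v p q : mder v (p * q) = mder v p * q + p * mder v q.
Proof.
rewrite /mder mulr_suml mulr_sumr -big_split; apply: eq_bigr => i _ /=.
by rewrite mderivM mulrDl mulrA [X in X + _]mulrAC.
Qed.

Lemma mderXn v p m : mder v (p ^+ m) = m%:R * p ^+ m.-1 * mder v p.
Proof.
elim: m => [|[|m] IHm] /=; first by rewrite expr0 !mul0r -mpolyC1 mderC.
  by rewrite expr1 expr0 !mul1r.
by rewrite exprS mderM IHm -[m.+2%:R]natr1 /= exprS; ring.
Qed.

Lemma mderiv_mder (i : 'I_d) p :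
  p^`M(i) = mder (fun j => (j == i)%:R) p.
Proof.
rewrite /mder (bigD1 i) //= eqxx mulr1 big1 ?addr0 // => j /negPf ->.
by rewrite mulr0.
Qed.

Lemma mder_comp m (lq : m.-tuple {mpoly R[d]}) v (q : {mpoly R[m]}) :
  mder v (q \mPo lq) = \sum_(i < m) (q^`M(i) \mPo lq) * mder v (tnth lq i).
Proof.
elim/mpoly_gen_ind: q => [c|i|p q Hp Hq|p q Hp Hq].
- by rewrite comp_mpolyC mderC big1 // => i _; rewrite mderivC comp_mpoly0 mul0r.
- rewrite comp_mpolyXU -tnth_nth (bigD1 i) //= mderivXU eqxx.
  rewrite comp_mpoly1 mul1r big1 ?addr0 // => j ne_ji.
  by rewrite mderivXU eq_sym (negPf ne_ji) comp_mpoly0 mul0r.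
- rewrite comp_mpolyD linearD /= Hp Hq -big_split; apply: eq_bigr => i _.
  by rewrite /= mderivD comp_mpolyD mulrDl.
rewrite rmorphM mderM Hp Hq mulr_suml mulr_sumr -big_split.
apply: eq_bigr => i _.
by rewrite /= mderivM comp_mpolyD !rmorphM /=; ring.
Qed.

End Derivation.

(* The coefficients of [wdecomp e p] are the components of [p] that are
   homogeneous for the weights [e]. Locked to keep unification from unfolding it. *)
HB.lock Definition wdecomp (k : fieldType) d (e : 'I_d -> nat)
    (p : {mpoly k[d]}) : {poly {mpoly k[d]}} :=
  mmap (polyC \o @mpolyC d k) (fun j => ('X_j)%:P * 'X^(e j)) p.

(** * Partial derivatives and algebraic independence in characteristic zero *)

Section CharZero.
Variables (k : fieldType) (char0 : [pchar k] =i pred0).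

Lemma natr_eq0_char0 n : (n%:R == 0 :> k) = (n == 0)%N.
Proof. by have /pcharf0P -> := char0. Qed.

Lemma msize_mderiv d (i : 'I_d) (p : {mpoly k[d]}) :
  p != 0 -> (msize p^`M(i) < msize p)%N.
Proof.
move=> p_neq0; have [-> | dp_neq0] := eqVneq p^`M(i) 0.
  by rewrite msize0 lt0n msize_poly_eq0.
rewrite -(mlead_deg dp_neq0).
have : mlead p^`M(i) \in msupp p^`M(i) by rewrite mlead_supp.
rewrite mcoeff_msupp mcoeff_mderiv => nz.
have /msize_mdeg_lt : (mlead p^`M(i) + U_(i))%MM \in msupp p.
  by rewrite mcoeff_msupp; apply: contraNneq nz => ->; rewrite mul0rn.
by rewrite mdegD mdeg1 addn1.
Qed.

Lemma mderiv_eq0 d (p : {mpoly k[d]}) :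
  (forall i, p^`M(i) = 0) -> p = (p@_0)%:MP.
Proof.
move=> dp0; apply/mpolyP => m; rewrite mcoeffC.
have [->|m_neq0] := eqVneq 0%MM m; first by rewrite mulr1.
have [i mi] : exists i, m i != 0%N.
  apply/existsP; apply: contraR m_neq0; rewrite negb_exists => /forallP m0.
  by apply/eqP/mnmP => i; rewrite mnm0E; apply/esym/eqP; have := m0 i; rewrite negbK.
have := congr1 (mcoeff (m - U_(i))%MM) (dp0 i).
rewrite mcoeff_mderiv mcoeff0 submK; last first.
  by apply/mnm_lepP => j; rewrite mnm1E; case: eqP => // <-; rewrite lt0n.
rewrite -(mulr_natl p@_m) mulr0 => /eqP; rewrite mulf_eq0 natr_eq0_char0 /=.
by move/eqP.
Qed.

(** The hypothesis makes the partial derivatives of a relation relations again. Being of smaller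
    size they vanish by induction, so in characteristic zero the relation is constant, hence
    zero. *)
Lemma comp_mpoly_inj d m (lq : m.-tuple {mpoly k[d]}) :
  (forall q, q \mPo lq = 0 -> forall i, q^`M(i) \mPo lq = 0) ->
  injective (comp_mpoly lq).
Proof.
move=> jac p q /eqP; rewrite -subr_eq0 -comp_mpolyB => /eqP.
move: (p - q) (subr_eq0 p q) => r r0 rlq; apply/eqP; rewrite -r0 {r0 p q}.
have [N] := ubnP (msize r); elim: N r rlq => // N IHN r rlq le_rN.
have dr0 i : r^`M(i) = 0.
  have [//|dr_neq0] := eqVneq r^`M(i) 0.
  apply/eqP; apply: IHN; first exact: jac.
  apply: leq_trans (msize_mderiv _ _) le_rN.
  by apply: contraNneq dr_neq0 => ->; rewrite mderiv0.
move: rlq; rewrite (mderiv_eq0 dr0) comp_mpolyC => /eqP.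
by rewrite mpolyC_eq0 => /eqP ->; rewrite mpolyC0.
Qed.

Lemma mderiv_comp d m (lq : m.-tuple {mpoly k[d]}) (q : {mpoly k[m]}) j :
  (q \mPo lq)^`M(j) =
    \sum_(i < m) (q^`M(i) \mPo lq) * (tnth lq i)^`M(j).
Proof.
rewrite mderiv_mder mder_comp.
by apply: eq_bigr => i _; rewrite -mderiv_mder.
Qed.

Lemma mder_map_polyM d (v : 'I_d -> {mpoly k[d]}) (P Q : {poly {mpoly k[d]}}) :
  map_poly (mder v) (P * Q) =
    map_poly (mder v) P * Q + P * map_poly (mder v) Q.
Proof.
apply/polyP => i; rewrite coefD coef_map !coefM raddf_sum -big_split.
by apply: eq_bigr => j _; rewrite /= mderM !coef_map.
Qed.

Lemma mder_map_polyXn d (v : 'I_d -> {mpoly k[d]}) n :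
  map_poly (mder v) 'X^n = 0.
Proof.
apply/polyP => i; rewrite coef_map coefXn coef0 /=.
by rewrite -mpolyC_nat mderC.
Qed.

Definition zpoly d (x : {mpoly k[d]}) (q : {poly k}) : {mpoly k[d]} :=
  (map_poly (@mpolyC d k) q).[x].

(** * Weights, homogeneous components and the Euler derivation *)

Section Grading.
Variables (d : nat) (e : 'I_d -> nat).
Local Notation S := {mpoly k[d]}.
Local Notation wdecomp := (@wdecomp k d e).
Implicit Types p q : S.

Definition euler : S -> S := mder (fun j => (e j)%:R * 'X_j).

HB.instance Definition _ := GRing.Linear.on euler.

Lemma eulerX j : euler 'X_j = (e j)%:R * 'X_j.
Proof. exact: mderX. Qed.

Lemma eulerM p q : euler (p * q) = euler p * q + p * euler q.
Proof. exact: mderM. Qed.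

Lemma eulerC c : euler c%:MP = 0.
Proof. exact: mderC. Qed.

Lemma euler_map_polyM (P Q : {poly S}) :
  map_poly euler (P * Q) = map_poly euler P * Q + P * map_poly euler Q.
Proof. exact: mder_map_polyM. Qed.

Lemma wdecompC c : wdecomp c%:MP = (c%:MP)%:P.
Proof. by rewrite wdecomp.unlock [LHS]mmapC. Qed.

Lemma wdecompX j : wdecomp 'X_j = ('X_j)%:P * 'X^(e j).
Proof. by rewrite wdecomp.unlock mmapX mmap1U. Qed.

Lemma wdecompD p q : wdecomp (p + q) = wdecomp p + wdecomp q.
Proof. by rewrite wdecomp.unlock [LHS]mmapD. Qed.

Lemma wdecompM p q : wdecomp (p * q) = wdecomp p * wdecomp q.
Proof. by rewrite wdecomp.unlock [LHS]rmorphM. Qed.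

Lemma wdecomp_horner1 p : (wdecomp p).[1] = p.
Proof.
elim/mpoly_gen_ind: p => [c|i|p q Hp Hq|p q Hp Hq].
- by rewrite wdecompC hornerC.
- by rewrite wdecompX hornerM hornerXn hornerC expr1n mulr1.
- by rewrite wdecompD hornerD Hp Hq.
by rewrite wdecompM hornerM Hp Hq.
Qed.

Lemma wdecomp_sum p : p = \sum_(i < size (wdecomp p)) (wdecomp p)`_i.
Proof.
rewrite -[LHS]wdecomp_horner1 horner_coef.
by apply: eq_bigr => i _; rewrite expr1n mulr1.
Qed.

(** Replacing each ['X_j] by ['X_j T^(e j)] turns the Euler derivation into [T d/dT], where [T] is
    the outer variable. *)
Lemma euler_wdecomp p : map_poly euler (wdecomp p) = 'X * (wdecomp p)^`().
Proof.
elim/mpoly_gen_ind: p => [c|i|p q Hp Hq|p q Hp Hq].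
- by rewrite wdecompC map_polyC derivC mulr0 /= eulerC polyC0.
- rewrite wdecompX derivM derivC mul0r add0r derivXn.
  rewrite euler_map_polyM [map_poly _ 'X^_]mder_map_polyXn mulr0 addr0 map_polyC /= eulerX.
  case: (e i) => [|n]; first by rewrite mulr0n !mulr0 mul0r polyC0 mul0r.
  by rewrite polyCM polyC_natr exprS -mulr_natl; ring.
- by rewrite wdecompD derivD mulrDr -Hp -Hq raddfD.
rewrite wdecompM euler_map_polyM derivM mulrDr !mulrA -Hp.
by rewrite Hq; ring.
Qed.

End Grading.

End CharZero.

Section EulerTheory.
Variables (k : fieldType) (char0 : [pchar k] =i pred0).
Variables (d : nat) (e : 'I_d -> nat).
Local Notation S := {mpoly k[d]}.
Local Notation euler := (@euler k d e).
Local Notation wdecomp := (@wdecomp k d e).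
Implicit Types p q : S.

Lemma euler_coef_wdecomp p i :
  euler (wdecomp p)`_i = i%:R *: (wdecomp p)`_i.
Proof.
have := congr1 (fun P : {poly S} => P`_i) (euler_wdecomp e p).
rewrite coef_map coefXM coef_deriv /= => ->.
by case: i => [|i] /=; rewrite ?scale0r // scaler_nat.
Qed.

(** Differentiation along ['X_j] lowers the weight by [e j]. *)
Lemma mderiv_euler j p :
  (euler p)^`M(j) = euler p^`M(j) + (e j)%:R *: p^`M(j).
Proof.
elim/mpoly_gen_ind: p => [c|i|p q Hp Hq|p q Hp Hq].
- by rewrite eulerC mderiv0 mderivC scaler0 addr0 linear0.
- rewrite eulerX mderivM -mpolyC_nat mderivC mul0r add0r mderivXU.
  have -> : euler (i == j)%:R = 0 by rewrite -mpolyC_nat eulerC.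
  by rewrite add0r mul_mpolyC; case: eqVneq => [->|_] //; rewrite !scaler0.
- by rewrite linearD !mderivD linearD Hp Hq /= scalerDr; ring.
rewrite eulerM !mderivD !mderivM [euler (_ + _)]linearD /= !eulerM Hp Hq -!mul_mpolyC; ring.
Qed.

Lemma eulerXm (m : 'X_{1..d}) :
  euler 'X_[m] = (\sum_j m j * e j)%:R *: 'X_[m].
Proof.
rewrite /euler /mder natr_sum scaler_suml; apply: eq_bigr => j _.
rewrite mderivX -mpolyC_nat mul_mpolyC -scalerAl -scalerAr scalerA -natrM.
rewrite -mpolyXD; have [->|mj] := eqVneq (m j) 0%N; first by rewrite !mul0n !scale0r.
congr (_ *: 'X_[_]); apply: submK; apply/mnm_lepP => i.
by rewrite mnm1E; case: eqP => // <-; rewrite lt0n.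
Qed.

(** Monomials are eigenvectors of [euler] with their weight as eigenvalue. In characteristic zero,
    eigenvalue zero leaves only powers of ['X_z]. *)
Lemma euler_eq0 (z : 'I_d) p : (forall j, j != z -> (0 < e j)%N) ->
  euler p = 0 -> exists q : {poly k}, p = zpoly 'X_z q.
Proof.
move=> e_gt0 ep0.
have mz m j : m \in msupp p -> j != z -> m j = 0%N.
  move=> mp ne_jz; have /negPf pm : p@_m != 0 by rewrite -mcoeff_msupp.
  have := congr1 (mcoeff m) ep0.
  rewrite [p]mpolyE [euler _]linear_sum raddf_sum mcoeff0 /= (bigD1_seq m) ?msupp_uniq //=.
  rewrite big1 => [|m' ne_m].
    rewrite linearZ mcoeffZ /= eulerXm mcoeffZ mcoeffX eqxx mulr1 addr0 => /eqP.
    rewrite mulf_eq0 pm /= (natr_eq0_char0 char0) sum_nat_eq0.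
    move=> /forallP/(_ j) /=; rewrite muln_eq0 => /orP[/eqP//|].
    by rewrite eqn0Ngt e_gt0.
  rewrite linearZ mcoeffZ /= eulerXm mcoeffZ mcoeffX (negPf ne_m).
  by rewrite !mulr0.
exists (\sum_(m <- msupp p) p@_m *: 'X^(m z)).
rewrite /zpoly raddf_sum horner_sum {1}[p]mpolyE big_seq [RHS]big_seq.
apply: eq_bigr => m mp; rewrite /= -mul_polyC rmorphM /= map_polyC map_polyXn.
rewrite hornerCM hornerXn mul_mpolyC mpolyXE_id (bigD1 z) //= big1 ?mulr1 //.
by move=> j ne_jz; rewrite (mz m) ?expr0.
Qed.

Lemma mder_zpoly v x (q : {poly k}) : mder v x = 0 -> mder v (zpoly x q) = 0 :> S.
Proof.
move=> dx0; rewrite /zpoly horner_coef linear_sum big1 // => i _ /=.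
by rewrite coef_map mderM mderC mul0r add0r mderXn dx0 !mulr0.
Qed.

(** Reduction modulo ['X_z]: a ring morphism into a domain that detects divisibility by the prime
    ['X_z]. *)
Definition kill (z : 'I_d) : S -> S :=
  mmap (@mpolyC d k) (fun j => if j == z then 0 else 'X_j).

HB.instance Definition _ z := GRing.RMorphism.on (kill z).

Lemma killX z : kill z 'X_z = 0.
Proof. by rewrite /kill mmapX mmap1U eqxx. Qed.

Lemma kill_split z p : exists q, p = kill z p + 'X_z * q.
Proof.
elim/mpoly_gen_ind: p => [c|i|p q [p' Hp] [q' Hq]|p q [p' Hp] [q' Hq]].
- by exists 0; rewrite /kill mmapC mulr0 addr0.
- case: (eqVneq i z) => [->|ne_iz]; first by exists 1; rewrite killX mulr1 add0r.
  by exists 0; rewrite /kill mmapX mmap1U (negPf ne_iz) mulr0 addr0.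
- by exists (p' + q'); rewrite {1}Hp {1}Hq rmorphD mulrDr; ring.
exists (kill z p * q' + p' * kill z q + 'X_z * p' * q').
by rewrite {1}Hp {1}Hq rmorphM; ring.
Qed.

Lemma kill_val z p : p != 0 -> exists s f, p = 'X_z ^+ s * f /\ kill z f != 0.
Proof.
have [N] := ubnP (msize p); elim: N p => // N IHN p le_pN p_neq0.
have [kp0|] := eqVneq (kill z p) 0; last first.
  by exists 0%N, p; rewrite expr0 mul1r.
have [q pE] := kill_split z p; rewrite kp0 add0r in pE.
have q_neq0 : q != 0 by apply: contraNneq p_neq0 => q0; rewrite pE q0 mulr0.
have X_neq0 : 'X_z != 0 :> S by rewrite -msize_poly_eq0 msizeX.
have [|s [f [qE kf]]] := IHN q _ q_neq0.
  by move: le_pN; rewrite pE msizeM // msizeX mdeg1.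
by exists s.+1, f; rewrite pE qE exprS mulrA.
Qed.

Lemma kill_zpoly z (q : {poly k}) : kill z (zpoly 'X_z q) = (q`_0)%:MP.
Proof.
rewrite /zpoly -horner_map /= killX horner_coef0 !coef_map /=.
by rewrite /kill mmapC.
Qed.

(** The prime ['X_z] does not divide [f], so each factor ['X_z] on the left must divide
    [zpoly 'X_z q], whose constant term therefore vanishes. *)
Lemma kill_divides z A f p (q : {poly k}) m : kill z f != 0 ->
  'X_z ^+ A * p = f ^+ m * zpoly 'X_z q ->
  exists q' : {poly k}, p = f ^+ m * zpoly 'X_z q'.
Proof.
move=> kf; elim: A q => [|A IHA] q; first by rewrite mul1r; exists q.
move=> E; have := congr1 (kill z) E.
rewrite exprS !rmorphM !rmorphXn /= killX !mul0r kill_zpoly => /esym/eqP.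
rewrite mulf_eq0 expf_eq0 (negPf kf) andbF mpolyC_eq0 /= => /eqP q0.
have [q1 qE] : exists q1 : {poly k}, q = q1 * 'X.
  have /factor_theorem[q1 ->] : root q 0 by rewrite /root horner_coef0 q0.
  by exists q1; rewrite polyC0 subr0.
have X_neq0 : 'X_z != 0 :> S by rewrite -msize_poly_eq0 msizeX.
apply: (IHA q1); apply: (mulfI X_neq0); rewrite mulrA -exprS E qE /zpoly.
by rewrite rmorphM /= map_polyX hornerMX; ring.
Qed.

End EulerTheory.

(** The condition in [coregular], for any predicate on a polynomial ring, so that the basis can be
    changed. *)
Definition polynomial_subalgebra (k : fieldType) d (P : {mpoly k[d]} -> Prop) :=
  exists (m : nat) (phi : {lrmorphism {mpoly k[m]} -> {mpoly k[d]}}),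
    injective phi /\ forall p, P p <-> exists q, phi q = p.

(** * Invariants of a graded bracket *)

Section GradedBracket.
Variables (k : fieldType) (char0 : [pchar k] =i pred0) (d : nat).
Variables (c : 'I_d -> 'I_d -> 'I_d -> k) (e : 'I_d -> nat) (N : nat).
Variables u z : 'I_d.
Local Notation S := {mpoly k[d]}.
Local Notation euler := (@euler k d e).
Local Notation wdecomp := (@wdecomp k d e).
Implicit Types p : S.

Definition bracket_var i j : S := \sum_l c i j l *: 'X_l.
Definition bracket_inv p := forall i, mder (bracket_var i) p = 0.

Hypotheses (neq_uz : u != z) (ez : e z = 0%N).
Hypothesis e_gt0 : forall i, i != z -> (0 < e i)%N.
Hypothesis e_inj : injective e.
Hypothesis c_grading : forall i j l, c i j l != 0 -> (e i + e j = N + e l)%N.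
Hypothesis z_central : forall i l, c i z l = 0.
Hypothesis z_pairing :
  forall a, a != u -> a != z -> exists a', c a' a z != 0.

(* [L] acts on invariants as the multiple [W z^-t] of [d/du]. *)
Definition proportional (b : bool) (L : S -> S) := exists t W,
  [/\ W^`M(u) = 0, b -> W = 0 &
      forall p, bracket_inv p -> 'X_z ^+ t * L p = W * p^`M(u)].

Lemma mderiv_z t : ('X_z ^+ t : S)^`M(u) = 0.
Proof.
by rewrite mderiv_mder mderXn -mderiv_mder mderivXU eq_sym (negPf neq_uz) mulr0.
Qed.

Lemma proportional_sum b (I : finType) (L : I -> S -> S) (A : pred I) :
  (forall i, A i -> proportional b (L i)) ->
  proportional b (fun p => \sum_(i | A i) L i p).
Proof.
move=> HL; elim: (index_enum I) => [|i s [t [W [dW Wb WE]]]].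
  by exists 0%N, 0; rewrite mderiv0; split=> // p _; rewrite big_nil mulr0 mul0r.
case Ai: (A i); last first.
  by exists t, W; split=> // p /WE; rewrite big_cons Ai.
have [t' [W' [dW' Wb' WE']]] := HL i Ai.
exists (t' + t)%N, ('X_z ^+ t * W' + 'X_z ^+ t' * W); split.
- by rewrite mderivD !mderivM !mderiv_z dW dW' !mul0r !mulr0 !addr0.
- by move=> bT; rewrite Wb // Wb' // !mulr0 addr0.
move=> p ip; rewrite big_cons Ai exprD mulrDl -!mulrA -WE // -WE' //; ring.
Qed.

Lemma proportional_mul b L G : G^`M(u) = 0 -> proportional b L ->
  proportional b (fun p => G * L p).
Proof.
move=> dG [t [W [dW Wb WE]]]; exists t, (G * W); split.
- by rewrite mderivM dG dW mul0r mulr0 addr0.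
- by move=> /Wb ->; rewrite mulr0.
by move=> p /WE E; rewrite -mulrA -E; ring.
Qed.

(* Pairing the gradient of an invariant with the partner of [a] expresses
   [z d/da] through derivatives along variables of larger [e]-weight. *)
Lemma gradient_proportional a : a != z ->
  proportional (e u < e a)%N (mderiv a).
Proof.
(* Downward induction on the weight [e a]. *)
have [M] := ubnP (\sum_j e j - e a)%N; elim: M a => // M IHM a le_aM ne_az.
have [->|ne_au] := eqVneq a u.
  exists 0%N, 1; split=> [||p _]; rewrite ?ltnn ?expr0 //.
  by rewrite -mpolyC1 mderivC.
have [a' ca] := z_pairing ne_au ne_az.
have e_aa' : (e a' + e a = N)%N by rewrite (c_grading ca) ez addn0.
(* The bracket has weight [e a' + e a - N = 0], and [z] is the only variable of weight 0. *)
have za : bracket_var a' a = c a' a z *: 'X_z.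
  rewrite /bracket_var (bigD1 z) //= big1 ?addr0 // => l ne_lz.
  have [->|/c_grading] := eqVneq (c a' a l) 0; first by rewrite scale0r.
  by have := e_gt0 ne_lz; lia.
(* The bracket of [a'] and [j] has weight [e j - e a], so only indices [j] of larger weight than [a]
   contribute, and the induction hypothesis covers these. *)
have [|t [W [dW Wb WE]]] := @proportional_sum (e u < e a)%N _
    (fun j p => bracket_var a' j * p^`M(j)) (fun j => j != a).
  move=> j ne_ja; have [lt_aj|le_ja] := ltnP (e a) (e j); last first.
    exists 0%N, 0; rewrite mderiv0; split=> // p _; rewrite mul0r.
    rewrite /bracket_var big1 ?mul0r ?mulr0 // => l _.
    have [->|/c_grading El] := eqVneq (c a' j l) 0; first by rewrite scale0r.
    have /e_inj E : e j = e a by lia.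
    by rewrite E eqxx in ne_ja.
  have ne_jz : j != z by apply: contraTneq lt_aj => ->; rewrite ez.
  have [|t [V [dV Vb VE]]] := IHM j _ ne_jz.
    have : (e j <= \sum_j e j)%N by rewrite (bigD1 j) //= leq_addr.
    by move: le_aM lt_aj; lia.
  exists t, (bracket_var a' j * V); split.
  - rewrite mderivM dV mulr0 addr0.
    (* If [e j <= e u], the variables of this bracket have weight below [e u], so ['X_u] does not
       occur. *)
    have [/Vb ->|le_ju] := ltnP (e u) (e j); first by rewrite mulr0.
    rewrite [_^`M(u)]linear_sum big1 ?mul0r // => l _ /=; rewrite mderivZ.
    have [->|/c_grading El] := eqVneq (c a' j l) 0; first by rewrite scale0r.
    rewrite mderivXU; case: eqVneq => [E|_]; last by rewrite scaler0.
    by have := e_gt0 ne_az; rewrite E in El; lia.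
  - by move=> lt_ua; rewrite Vb ?mulr0 // (ltn_trans lt_ua).
  by move=> p /VE E; rewrite -mulrA -E; ring.
(* Invariance under [a'] is solved for [z d/da]. *)
exists t.+1, (- (c a' a z)^-1 *: W); split.
- by rewrite mderivZ dW scaler0.
- by move=> /Wb ->; rewrite scaler0.
move=> p ip; rewrite -scalerAl -WE //.
have E : c a' a z *: ('X_z * p^`M(a)) =
    - \sum_(j | j != a) bracket_var a' j * p^`M(j).
  apply/eqP; rewrite -addr_eq0 scalerAl -za; apply/eqP.
  rewrite -[RHS](ip a') /mder [RHS](bigD1 a) //= mulrC.
  by congr (_ + _); apply: eq_bigr => j _; rewrite mulrC.
rewrite exprSr -mulrA scaleNr scalerAr -mulrN; congr (_ * _).
by rewrite -scalerN -E scalerA mulVf // scale1r.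
Qed.

(** The term of the Euler sum at [u] gives the part of [H] linear in ['X_u]; the others contribute
    multiples of [d/du] free of ['X_u]. *)
Lemma euler_proportional : exists T H,
  H^`M(u) = (e u)%:R *: 'X_z ^+ T /\
  forall p, bracket_inv p -> 'X_z ^+ T * euler p = H * p^`M(u).
Proof.
have [|T [W [dW _ WE]]] := @proportional_sum false _
    (fun j p => ((e j)%:R * 'X_j) * p^`M(j)) (fun j => j != u).
  move=> j ne_ju; have [->|ne_jz] := eqVneq j z.
    exists 0%N, 0; rewrite mderiv0; split=> // p _.
    by rewrite ez !mul0r mulr0.
  have [t [V [dV _ VE]]] := gradient_proportional ne_jz.
  apply: proportional_mul; last by exists t, V.
  by rewrite mderivM -mpolyC_nat mderivC mderivXU (negPf ne_ju) mul0r mulr0 addr0.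
exists T, ((e u)%:R *: ('X_z ^+ T * 'X_u) + W); split.
  by rewrite mderivD mderivZ mderivM mderiv_z dW mderivXU eqxx mulr1 mul0r add0r addr0.
move=> p ip; rewrite mulrDl -WE // /euler /mder (bigD1 u) //= mulrDr.
congr (_ + _ * _); last by apply: eq_bigr => j _; rewrite mulrC.
by rewrite -mul_mpolyC mpolyC_nat; ring.
Qed.

(** The derivation along [j] shifts all weights by [e j - N], so it kills each component separately.
    In [E] the power ['X^N] stands on the left because the shift may be negative. *)
Lemma wdecomp_inv p i : bracket_inv p -> bracket_inv (wdecomp p)`_i.
Proof.
move=> ip j.
have E q : wdecomp (mder (bracket_var j) q) * 'X^N =
    'X^(e j) * map_poly (mder (bracket_var j)) (wdecomp q).
  elim/mpoly_gen_ind: q => [a|l|q r Hq Hr|q r Hq Hr].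
  - rewrite mderC wdecompC map_polyC /= mderC polyC0 mulr0.
    by rewrite -mpolyC0 wdecompC mpolyC0 polyC0 mul0r.
  - rewrite mderX wdecompX mder_map_polyM mder_map_polyXn mulr0 addr0 map_polyC.
    rewrite /= mderX /bracket_var.
    have wZ a q : wdecomp (a *: q) = (a%:MP)%:P * wdecomp q.
      by rewrite -mul_mpolyC wdecompM wdecompC.
    have -> : wdecomp (\sum_m c j l m *: 'X_m) =
        \sum_m (c j l m)%:MP%:P * (('X_m)%:P * 'X^(e m)).
      elim/big_rec2: _ => [|m a b _ IH].
        by rewrite -mpolyC0 wdecompC mpolyC0.
      by rewrite wdecompD wZ wdecompX IH.
    rewrite raddf_sum !mulr_suml mulr_sumr; apply: eq_bigr => m _ /=.
    have [->|/c_grading El] := eqVneq (c j l m) 0.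
      by rewrite mpolyC0 !polyC0 scale0r polyC0 !mul0r mulr0.
    rewrite -!mulrA -exprD [(e m + N)%N]addnC -El exprD -mul_mpolyC polyCM; ring.
  - by rewrite [mder _ (q + r)]linearD !wdecompD raddfD mulrDl mulrDr Hq Hr.
  rewrite mderM wdecompD !wdecompM mder_map_polyM mulrDl mulrDr.
  by rewrite mulrAC Hq -!mulrA Hr; ring.
have := congr1 (fun P : {poly S} => P`_(i + e j)) (E p).
rewrite ip -mpolyC0 wdecompC mpolyC0 polyC0 mul0r coef0.
rewrite mulrC coefMXn ltnNge leq_addl /= addnK coef_map => <-.
by [].
Qed.
(** With [D i] the [i]-th derivative of [p] along [u], the Euler identity differentiates to
    [H D_(i+1) = (E - i e_u) z^T D_i]. If [D m] is the last nonzero derivative, then [E = m e_u], so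
    [D m] has weight zero and is a polynomial in [z]. Multiplying the identities for [i < m], whose
    factors are nonzero, makes [H^m D_m] a nonzero multiple of [z^(T m) p], and the powers of [z]
    cancel. *)
Lemma homogeneous_inv H f T s E p :
  H^`M(u) = (e u)%:R *: 'X_z ^+ T ->
  (forall q, bracket_inv q -> 'X_z ^+ T * euler q = H * q^`M(u)) ->
  H = 'X_z ^+ s * f -> kill z f != 0 ->
  bracket_inv p -> euler p = E%:R *: p ->
  exists m (q : {poly k}), p = f ^+ m * zpoly 'X_z q.
Proof.
move=> dH HE Hf kf ip pE; have [p0|p_neq0] := eqVneq p 0.
  by exists 0%N, 0; rewrite p0 /zpoly map_poly0 horner0 mulr0.
pose D i := iter i (mderiv u) p.
have X_neq0 t : 'X_z ^+ t != 0 :> S.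
  by rewrite expf_neq0 // -msize_poly_eq0 msizeX.
have eulerD i : euler (D i) = (E%:R - (i * e u)%:R) *: D i.
  elim: i => [|i IHi]; first by rewrite mul0n subr0.
  have := mderiv_euler e u (D i); rewrite -/(D i.+1) IHi mderivZ => /eqP.
  rewrite -subr_eq => /eqP <-; rewrite -[(D i)^`M(u)]/(D i.+1) -scalerBl.
  by congr (_ *: _); rewrite mulSn natrD; ring.
have HD i : H * D i.+1 = (E%:R - (i * e u)%:R) *: ('X_z ^+ T * D i).
  elim: i => [|i IHi]; first by rewrite mul0n subr0 -HE // pE scalerAr.
  have := congr1 (mderiv u) IHi; rewrite mderivZ !mderivM dH mderiv_z mul0r add0r.
  rewrite -!/(D _.+1) => /eqP; rewrite addrC eq_sym -subr_eq => /eqP <-.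
  by rewrite -scalerAl -scalerBl; congr (_ *: _); rewrite mulSn natrD; ring.
have [m [Dm DSm]] : exists m, D m != 0 /\ D m.+1 = 0.
  have exD : exists i, D i == 0.
    suff le_D i : (msize (D i) <= msize p - i)%N.
      exists (msize p); rewrite -msize_poly_eq0 -leqn0.
      by rewrite (leq_trans (le_D _)) ?subnn.
    elim: i => [|i IHi]; first by rewrite subn0.
    have [D0|/(msize_mderiv u)] := eqVneq (D i) 0; last first.
      by rewrite [D i.+1]iterS -/(D i) => /leq_trans/(_ IHi); lia.
    by rewrite /D iterS -/(D i) D0 mderiv0 msize0.
  case: (ex_minnP exD) => [[|m] Dm0 minD]; first by rewrite /D /= (negPf p_neq0) in Dm0.
  exists m; split; last exact/eqP.
  by apply/negP => /minD; rewrite ltnn.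
have Em : E%:R - (m * e u)%:R = 0 :> k.
  have /eqP := HD m; rewrite DSm mulr0 eq_sym scaler_eq0 mulf_eq0.
  by rewrite (negPf Dm) (negPf (X_neq0 _)) !orbF => /eqP.
have [q qE] : exists q : {poly k}, D m = zpoly 'X_z q.
  by apply: (euler_eq0 char0 e_gt0); rewrite eulerD Em scale0r.
have HDi i : (i <= m)%N -> exists2 a, a != 0 &
    H ^+ i * D i = a *: ('X_z ^+ (T * i) * p).
  elim: i => [|i IHi] lt_im; first by exists 1; rewrite ?oner_neq0 // scale1r muln0 !expr0 !mul1r.
  have [a a_neq0 aE] := IHi (ltnW lt_im).
  exists ((E%:R - (i * e u)%:R) * a).
    rewrite mulf_neq0 // (subr0_eq Em) -natrB; last first.
      by rewrite leq_mul2r ltnW ?orbT.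
    rewrite (natr_eq0_char0 char0) -mulnBl muln_eq0 negb_or -!lt0n subn_gt0 lt_im.
    exact: e_gt0.
  rewrite exprSr -mulrA HD -scalerAr mulrCA aE -scalerAr scalerA mulnS exprD.
  by rewrite mulrA.
have [a a_neq0 aE] := HDi m (leqnn m).
exists m; apply: (@kill_divides _ _ z (T * m) f p (a^-1 *: ('X^(s * m) * q)) m kf).
rewrite -['X_z ^+ _ * p]scale1r -(mulVf a_neq0) -scalerA -aE Hf qE exprMn.
rewrite /zpoly -mul_polyC !rmorphM /= map_polyC map_polyXn !hornerM hornerC hornerXn /=.
by rewrite -mul_mpolyC exprM; ring.
Qed.

Theorem graded_polynomial_inv : polynomial_subalgebra bracket_inv.
Proof.
have [T [H [dH HE]]] := euler_proportional.
have X_neq0 t : 'X_z ^+ t != 0 :> S.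
  by rewrite expf_neq0 // -msize_poly_eq0 msizeX.
have dH_neq0 : H^`M(u) != 0.
  by rewrite dH scaler_eq0 negb_or X_neq0 (natr_eq0_char0 char0) -lt0n e_gt0.
have H_neq0 : H != 0 by apply: contraNneq dH_neq0 => ->; rewrite mderiv0.
have [s [f [Hf kf]]] := kill_val z H_neq0.
have df_neq0 : f^`M(u) != 0.
  apply: contraNneq dH_neq0 => df0.
  by rewrite Hf mderivM mderiv_z df0 mul0r mulr0 addr0.
have iz : bracket_inv 'X_z.
  by move=> i; rewrite mderX /bracket_var big1 // => l _; rewrite z_central scale0r.
have inv_zpoly q : bracket_inv (zpoly 'X_z q) by move=> i; rewrite mder_zpoly.
have wE p i : bracket_inv p ->
    exists m (q : {poly k}), (wdecomp p)`_i = f ^+ m * zpoly 'X_z q.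
  move=> ip; apply: (homogeneous_inv dH HE Hf kf); first exact: wdecomp_inv.
  exact: euler_coef_wdecomp.
have zpoly_comp n (lq : n.-tuple S) (i : 'I_n) (q : {poly k}) :
    zpoly (tnth lq i) q = zpoly 'X_i q \mPo lq.
  rewrite /zpoly !horner_coef linear_sum !size_map_poly; apply: eq_bigr => j _ /=.
  rewrite rmorphM rmorphXn /= comp_mpolyXU -tnth_nth !coef_map /=.
  by rewrite comp_mpolyC.
have comp_inv n (lq : n.-tuple S) : (forall i, bracket_inv (tnth lq i)) ->
    forall q, bracket_inv (q \mPo lq).
  by move=> ilq q i; rewrite mder_comp big1 // => j _; rewrite ilq mulr0.
have [inv_f|ninv_f] := pselect (bracket_inv f).
  pose lq : 2.-tuple S := [tuple 'X_z; f].
  exists 2%N, (comp_mpoly lq); split.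
    (* The derivative [d/du] kills ['X_z] but not [f], which settles the partial derivative of [q]
       along the second variable; [d/dz] then settles the first. *)
    apply: (comp_mpoly_inj char0) => q qlq.
    have d1 : q^`M(lift ord0 ord0) \mPo lq = 0.
      have := congr1 (mderiv u) qlq; rewrite mderiv_comp mderiv0 /=.
      rewrite !big_ord_recl big_ord0 !(tnth_nth 0) /= mderivXU eq_sym (negPf neq_uz).
      rewrite mulr0 add0r addr0 => /eqP; rewrite mulf_eq0 (negPf df_neq0) orbF.
      by move/eqP.
    have d0 : q^`M(ord0) \mPo lq = 0.
      have := congr1 (mderiv z) qlq; rewrite mderiv_comp mderiv0 /=.
      rewrite !big_ord_recl big_ord0 d1 mul0r !addr0 !(tnth_nth 0) /= mderivXU.
      by rewrite eqxx mulr1.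
    move=> i; case: (unliftP ord0 i) => [j|] -> //.
    by rewrite (ord1 j).
  move=> p; split=> [ip|[q <-]]; last first.
    apply: comp_inv => i; rewrite (tnth_nth 0).
    by case: i => [[|[|//]] ? ] /=.
  suff im i : exists q, comp_mpoly lq q = (wdecomp p)`_i.
    rewrite (wdecomp_sum e p); elim/big_rec: _ => [|i _ _ [q <-]].
      by exists 0; rewrite linear0.
    by have [r <-] := im i; exists (r + q); rewrite linearD.
  have [m [q ->]] := wE p i ip.
  exists ('X_(lift ord0 ord0) ^+ m * zpoly 'X_ord0 q).
  by rewrite rmorphM rmorphXn /= -zpoly_comp comp_mpolyXU.
pose lq : 1.-tuple S := [tuple 'X_z].
exists 1%N, (comp_mpoly lq); split.
  apply: (comp_mpoly_inj char0) => q qlq i.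
  have := congr1 (mderiv z) qlq; rewrite mderiv_comp mderiv0 /=.
  rewrite !big_ord_recl big_ord0 !addr0 !(tnth_nth 0) /= mderivXU eqxx mulr1.
  by rewrite (ord1 i).
move=> p; split=> [ip|[q <-]]; last first.
  by apply: comp_inv => i; rewrite (tnth_nth 0) (ord1 i).
suff im i : exists q, comp_mpoly lq q = (wdecomp p)`_i.
  rewrite (wdecomp_sum e p); elim/big_rec: _ => [|i _ _ [q <-]].
    by exists 0; rewrite linear0.
  by have [r <-] := im i; exists (r + q); rewrite linearD.
have [m [q wpE]] := wE p i ip.
have [w0|w_neq0] := eqVneq (wdecomp p)`_i 0.
  by exists 0; rewrite w0 linear0.
(* For [m > 0], applying a derivation [D] to [f^m q(z)] gives [m f^(m-1) q(z) D(f) = 0], which would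
   make [f] invariant. *)
have m0 : m = 0%N.
  case: m wpE => // m wpE; case: ninv_f => j.
  have := wdecomp_inv i ip j; rewrite wpE mderM inv_zpoly mulr0 addr0 mderXn => /eqP.
  rewrite !mulf_eq0 -mpolyC_nat mpolyC_eq0 (natr_eq0_char0 char0) /= expf_eq0.
  have /negPf -> : zpoly 'X_z q != 0.
    by apply: contraNneq w_neq0 => q0; rewrite wpE q0 mulr0.
  have /negPf -> : f != 0 by apply: contraNneq kf => ->; rewrite rmorph0.
  by rewrite andbF orbF => /eqP.
by exists (zpoly 'X_ord0 q); rewrite wpE m0 expr0 mul1r -zpoly_comp.
Qed.

End GradedBracket.

(** * Change of basis in the symmetric algebra *)

Section BasisChange.
Variables (k : fieldType) (g : lieAlgType k).
Variable X : (\dim {:g}).-tuple g.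
Hypothesis bX : basis_of {:g} X.
Local Notation S := (symalg g).

Definition struct_const (i j l : 'I_(\dim {:g})) : k := coord X l (lieb X`_i X`_j).

Let lin (x : g) : S := \sum_l coord X l x *: 'X_l.

Fact lin_is_linear : linear lin.
Proof.
move=> a x y; rewrite /lin scaler_sumr -big_split; apply: eq_bigr => i _.
by rewrite linearP /= scalerDl scalerA.
Qed.
HB.instance Definition _ := GRing.isLinear.Build k g S _ lin lin_is_linear.

(** In the source of [tau] the variables stand for the vectors of [X], in its target for those of
    [vbasis {:g}]; [tau'] is the inverse. *)
Let tau : S -> S := comp_mpoly [tuple symalg_in X`_i | i < \dim {:g}].
Let tau' : S -> S := comp_mpoly [tuple lin (vbasis {:g})`_i | i < \dim {:g}].

Fact tau_lin x : tau (lin x) = symalg_in x.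
Proof.
rewrite [x in RHS](coord_basis bX (memvf x)) [RHS]linear_sum /lin [LHS]linear_sum.
apply: eq_bigr => i _; rewrite !linearZ /= comp_mpolyXU.
by rewrite nth_mktuple.
Qed.

Fact tau'_in x : tau' (symalg_in x) = lin x.
Proof.
rewrite [x in RHS](coord_vbasis (memvf x)) [RHS]linear_sum /symalg_in [LHS]linear_sum.
apply: eq_bigr => i _; rewrite !linearZ /= comp_mpolyXU.
by rewrite nth_mktuple.
Qed.

Fact lin_basis (i : 'I_(\dim {:g})) : lin X`_i = 'X_i.
Proof.
rewrite /lin (bigD1 i) //= big1 => [|j ne_ji].
  by rewrite coord_free ?(basis_free bX) // eqxx scale1r addr0.
by rewrite coord_free ?(basis_free bX) // eq_sym (negPf ne_ji) scale0r.
Qed.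

Fact tauK : cancel tau tau'.
Proof.
elim/mpoly_gen_ind => [a|i|p q Hp Hq|p q Hp Hq].
- by rewrite /tau /tau' !comp_mpolyC.
- by rewrite /tau comp_mpolyXU nth_mktuple tau'_in lin_basis.
- by rewrite /tau /tau' !comp_mpolyD; congr (_ + _).
by rewrite /tau /tau' !rmorphM; congr (_ * _).
Qed.

Fact tau'K : cancel tau' tau.
Proof.
elim/mpoly_gen_ind => [a|i|p q Hp Hq|p q Hp Hq].
- by rewrite /tau /tau' !comp_mpolyC.
- by rewrite /tau' comp_mpolyXU nth_mktuple tau_lin symalg_in_basis.
- by rewrite /tau /tau' !comp_mpolyD; congr (_ + _).
by rewrite /tau /tau' !rmorphM; congr (_ * _).
Qed.

Fact symalg_ad_tau (i : 'I_(\dim {:g})) p :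
  symalg_ad X`_i (tau p) = tau (mder (bracket_var struct_const i) p).
Proof.
rewrite [LHS]mder_comp [mder _ p]/mder /tau [RHS]linear_sum; apply: eq_bigr => j _.
rewrite /= [in RHS]rmorphM /=; congr (_ * _).
rewrite tnth_mktuple [LHS]symalg_ad_in -tau_lin; congr (tau _).
Qed.

Lemma sym_invariant_basis p :
  bracket_inv struct_const p <-> sym_invariant (tau p).
Proof.
split=> [ip x | ip i]; last first.
  by rewrite -[LHS]tauK -symalg_ad_tau ip /tau' comp_mpoly0.
have -> : symalg_ad x (tau p) = \sum_i coord X i x *: symalg_ad X`_i (tau p).
  rewrite /symalg_ad.
  under [RHS]eq_bigr do rewrite scaler_sumr.
  rewrite exchange_big; apply: eq_bigr => j _ /=.
  under eq_bigr do rewrite scalerAr.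
  rewrite -mulr_sumr; congr (_ * _).
  rewrite {1}(coord_basis bX (memvf x)).
  pose L : {linear g -> g} := HB.pack (@lieb k g ^~ (vbasis {:g})`_j)
    (GRing.isLinear.Build k g g _ _ (lieb_is_linearl (vbasis {:g})`_j)).
  rewrite -[lieb _ _]/(L _) !linear_sum; apply: eq_bigr => i _.
  by rewrite [L _]linearZ linearZ.
by rewrite big1 // => i _; rewrite symalg_ad_tau ip /tau comp_mpoly0 scaler0.
Qed.

Lemma coregular_basis :
  coregular g <-> polynomial_subalgebra (bracket_inv struct_const).
Proof.
split=> -[m [phi [phi_inj phiP]]].
  exists m, (comp_mpoly [tuple lin (vbasis {:g})`_i | i < \dim {:g}] \o phi).
  split=> [|p]; first exact/(inj_comp (can_inj tau'K) phi_inj).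
  split=> [/sym_invariant_basis/phiP[q qE]|[q <-]].
    by exists q; rewrite /= qE [LHS]tauK.
  apply/sym_invariant_basis; rewrite [tau _]tau'K; apply/phiP.
  by exists q.
exists m, (comp_mpoly [tuple symalg_in X`_i | i < \dim {:g}] \o phi).
split=> [|p]; first exact/(inj_comp (can_inj tauK) phi_inj).
split=> [ip|[q <-]].
  have /phiP[q qE] : bracket_inv struct_const (tau' p).
    by apply/sym_invariant_basis; rewrite tau'K.
  by exists q; rewrite /= qE [LHS]tau'K.
by apply/sym_invariant_basis/phiP; exists q.
Qed.

End BasisChange.

(** * Bounds for the index *)

Section Index.
Variables (k : fieldType) (g : lieAlgType k).

Lemma lie_index_le (xi : 'Hom(g, k^o)) : (lie_index g <= \dim (lie_radical xi))%N.
Proof.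
rewrite /lie_index; case: ex_minnP => d _; apply.
by apply/asboolP; exists xi.
Qed.

Lemma dim_cap_lker (U : {vspace g}) (f : 'Hom(g, k^o)) :
  (\dim U <= (\dim (U :&: lker f)).+1)%N.
Proof.
rewrite -(limg_ker_dim f U) -addn1 leq_add2l.
by rewrite (leq_trans (dimvS (subvf _))) // dimvf.
Qed.

(** For every [xi], the elements of the abelian space [U] that are [xi]-orthogonal to [Y] lie in the
    radical, and each vector of [Y] costs at most one dimension. *)
Lemma lie_index_ge (U : {vspace g}) (Y : seq g) :
  (forall x y, x \in U -> y \in U -> lieb x y = 0) ->
  (U + <<Y>>)%VS = fullv -> (\dim U - size Y <= lie_index g)%N.
Proof.
move=> abU UY; rewrite /lie_index; case: ex_minnP => d /asboolP[xi <-] _.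
have lf y : {f : 'Hom(g, k^o) | forall x, f x = xi (lieb x y)}.
  have lin_f : linear (fun x => xi (lieb x y) : k^o).
    by move=> a u v; rewrite lieb_linearl linearP.
  pose L : {linear g -> k^o} := HB.pack (fun x => xi (lieb x y) : k^o)
    (GRing.isLinear.Build k g k^o _ _ lin_f).
  by exists (linfun L) => x; rewrite lfunE.
have [K [KU KY dK]] : exists K : {vspace g}, [/\ (K <= U)%VS,
    forall x y, x \in K -> y \in Y -> xi (lieb x y) = 0 &
    (\dim U - size Y <= \dim K)%N].
  elim: Y {UY} => [|y Y [K [KU KY dK]]].
    by exists U; rewrite subvv subn0; split.
  have [f fE] := lf y; exists (K :&: lker f)%VS; split.
  - exact: subv_trans (capvSl _ _) KU.
  - move=> x y'; rewrite memv_cap memv_ker => /andP[xK /eqP fx].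
    rewrite inE => /predU1P[->|]; last exact: KY.
    by rewrite -fE.
  by have := dim_cap_lker K f; rewrite /= ; lia.
apply: leq_trans dK (dimvS _); apply/subvP => x xK; apply/mem_lie_radical => y.
have : y \in (U + <<Y>>)%VS by rewrite UY memvf.
case/memv_addP => v vU [w wY ->].
have xU : x \in U by apply: (subvP KU).
rewrite [lieb x _]linearD /= (abU x v xU vU) add0r.
rewrite (coord_span (X := in_tuple Y) wY).
rewrite (linear_sum (lieb x)) linear_sum big1 // => i _.
by rewrite !linearZ /= KY ?scaler0 // mem_nth.
Qed.

End Index.

(** * The obstruction to polynomiality *)

Section NonPolynomial.
Variables (k : fieldType) (d : nat) (y : 'I_d).
Local Notation S := {mpoly k[d]}.
Implicit Types p : S.

Definition restr_axis : S -> {poly k} :=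
  mmap polyC (fun j => if j == y then 'X else 0).

HB.instance Definition _ := GRing.RMorphism.on restr_axis.

Lemma restr_axisX j : restr_axis 'X_j = if j == y then 'X else 0.
Proof. by rewrite /restr_axis mmapX mmap1U. Qed.

Lemma restr_axis_coef p :
  (restr_axis p)`_0 = p@_0 /\ (restr_axis p)`_1 = (p^`M(y))@_0.
Proof.
elim/mpoly_gen_ind: p => [c|i|p q [p0 p1] [q0 q1]|p q [p0 p1] [q0 q1]].
- rewrite /restr_axis mmapC !coefC /= mderivC mcoeff0.
  by rewrite -[c%:MP]mulr1 mul_mpolyC mcoeffZ mcoeff1 eqxx mulr1.
- rewrite restr_axisX mderivXU mcoeffX mnm1_eq0 /= -mpolyC_nat mpolyCK.
  by case: eqVneq => _; rewrite ?coefX ?coef0.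
- by rewrite rmorphD !coefD mderivD !mcoeffD p0 p1 q0 q1.
rewrite rmorphM !coefM !big_ord_recr !big_ord0 /= p0 p1 q0 q1 !add0r mderivM.
by rewrite mcoeffD !(rmorphM (mcoeff 0%MM)) /= addrC.
Qed.

(** Brackets are linear forms without constant term, so differentiating the invariance equation for
    [i] along [y0] at the origin leaves only the derivative of [p] along [y] there. *)
Lemma restr_axis_inv (c : 'I_d -> 'I_d -> 'I_d -> k) i y0 p :
  (forall j, c i j y0 = (j == y)%:R) -> bracket_inv c p ->
  (restr_axis p)`_1 = 0.
Proof.
move=> cE ip; have [_ ->] := restr_axis_coef p.
have := congr1 (fun q => (q^`M(y0))@_0) (ip i).
rewrite mderiv0 mcoeff0 /mder [_^`M(y0)]linear_sum raddf_sum /= => E; rewrite -[RHS]E.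
have bv0 j : (bracket_var c i j)@_0 = 0.
  rewrite /bracket_var raddf_sum big1 // => l _ /=.
  by rewrite mcoeffZ mcoeffX mnm1_eq0 mulr0.
have bv1 j : ((bracket_var c i j)^`M(y0))@_0 = (j == y)%:R.
  rewrite /bracket_var [_^`M(y0)]linear_sum raddf_sum (bigD1 y0) //= big1 => [|l ne_l].
    by rewrite mderivZ mcoeffZ mderivXU eqxx mcoeff1 eqxx mulr1 addr0 cE.
  by rewrite mderivZ mcoeffZ mderivXU (negPf ne_l) mcoeff0 mulr0.
have D j : ((p^`M(j) * bracket_var c i j)^`M(y0))@_0 = p^`M(j)@_0 * (j == y)%:R.
  by rewrite mderivM mcoeffD !(rmorphM (mcoeff 0%MM)) /= bv0 bv1 mulr0 add0r.
under eq_bigr do rewrite D.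
by rewrite (bigD1 y) //= eqxx mulr1 big1 ?addr0 // => j /negPf ->; rewrite mulr0.
Qed.

(* On the image of [phi] the [r]-th coefficient is a derivation at the origin,
   since first coefficients vanish; it is the tangent vector of the line [psi]. *)
Lemma tangent_line m (phi : {lrmorphism {mpoly k[m]} -> S}) r :
  (r == 2%N) || (r == 3%N) ->
  (forall q, (restr_axis (phi q))`_1 = 0) ->
  exists psi : {rmorphism {mpoly k[m]} -> {poly k}}, forall q,
    (psi q)`_0 = (restr_axis (phi q))`_0 /\
    (psi q)`_1 = (restr_axis (phi q))`_r.
Proof.
move=> r23 chi1.
pose h i := ((restr_axis (phi 'X_i))`_0)%:P + ((restr_axis (phi 'X_i))`_r)%:P * 'X.
exists (mmap polyC h).
elim/mpoly_gen_ind => [c|i|p q [p0 p1] [q0 q1]|p q [p0 p1] [q0 q1]].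
- have -> : phi c%:MP = c%:MP.
    by rewrite -[c%:MP in LHS]mulr1 mul_mpolyC linearZ /= rmorph1 -mul_mpolyC mulr1.
  rewrite /= mmapC.
  by rewrite /restr_axis mmapC !coefC; case/orP: r23 => /eqP ->.
- rewrite /= mmapX mmap1U /h !coefD !coefC !coefMX !coefC /=.
  by rewrite addr0 add0r.
- by rewrite !rmorphD !coefD p0 p1 q0 q1.
rewrite !rmorphM !coefM !big_ord_recr !big_ord0 /= p0 p1 q0 q1 !add0r.
(* As [r] is 2 or 3, every mixed term in the [r]-th coefficient of the product contains a first
   coefficient, which is zero. *)
have := chi1 p; have := chi1 q.
case/orP: r23 => /eqP -> q1' p1'; rewrite !big_ord_recr !big_ord0 /= p1' q1'.
  by split=> //; ring.
by split=> //; ring.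
Qed.

Lemma poly_root0 (p : {poly k}) : p`_0 = 0 ->
  exists2 q : {poly k}, p = q * 'X & q`_0 = p`_1.
Proof.
move=> p0; have /factor_theorem[q pE] : root p 0 by rewrite /root horner_coef0 p0.
by exists q; rewrite pE polyC0 subr0 // coefMX.
Qed.

Lemma poly_double_root0 (p : {poly k}) : p`_0 = 0 -> p`_1 = 0 ->
  exists q : {poly k}, p = q * 'X * 'X.
Proof. by move=> /poly_root0[q ->] qE /[!coefMX]/= /poly_root0[r -> _]; exists r. Qed.

Section Relations.
Variable P : S -> Prop.
Hypothesis P_linear : forall p, P p -> (restr_axis p)`_1 = 0.
Variables A B Z G : S.
Hypotheses (PA : P A) (PB : P B) (PZ : P Z) (PG : P G).
Hypothesis restr_Z : restr_axis Z = 0.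

Lemma not_polynomial_23 :
  restr_axis A = 'X^2 -> restr_axis B = 'X^3 -> B ^+ 2 = A ^+ 3 + Z ^+ 2 * G ->
  ~ polynomial_subalgebra P.
Proof.
move=> rA rB rel [m [phi [phi_inj phiP]]].
have chi1 q : (restr_axis (phi q))`_1 = 0.
  by apply: P_linear; apply/phiP; exists q.
have [psi psiE] := @tangent_line m phi 2 isT chi1.
have [/phiP[a aE] /phiP[b bE]] := (PA, PB).
have [/phiP[z zE] /phiP[g gE]] := (PZ, PG).
have {rel} : psi b ^+ 2 = psi a ^+ 3 + psi z ^+ 2 * psi g.
  rewrite -!rmorphXn -rmorphM -rmorphD; congr (psi _); apply: phi_inj.
  by rewrite [LHS]rmorphXn [RHS]rmorphD [X in _ + X]rmorphM !rmorphXn /= aE bE zE gE.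
have [] := psiE a; rewrite aE rA !coefXn /= => a0 a1.
have [] := psiE b; rewrite bE rB !coefXn /= => b0 b1.
have [] := psiE z; rewrite zE restr_Z !coef0 => z0 z1.
have [a' psi_a] := poly_root0 a0; rewrite a1 {}psi_a => a'0.
have [b' ->] := poly_double_root0 b0 b1; have [z' ->] := poly_double_root0 z0 z1.
(* The other two terms have order at least 4, so after division by ['X^3] the value at 0 is
   [- a'(0)^3 = -1]. *)
move=> rel; have : 'X^3 * (b' ^+ 2 * 'X - a' ^+ 3 - z' ^+ 2 * psi g * 'X) = 0.
  transitivity ((b' * 'X * 'X) ^+ 2 - (a' * 'X) ^+ 3 - (z' * 'X * 'X) ^+ 2 * psi g).
    by ring.
  by rewrite rel; ring.
move/eqP; rewrite mulf_eq0 expf_eq0 polyX_eq0 andbF /= => /eqP.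
move/(congr1 (horner^~ 0)); rewrite !hornerE.
by rewrite horner_coef0 a'0 expr1n subr0 => /eqP; rewrite oppr_eq0 oner_eq0.
Qed.

Lemma not_polynomial_34 :
  restr_axis A = 'X^3 -> restr_axis B = - 'X^4 ->
  B ^+ 3 = - A ^+ 4 + Z ^+ 3 * G -> ~ polynomial_subalgebra P.
Proof.
move=> rA rB rel [m [phi [phi_inj phiP]]].
have chi1 q : (restr_axis (phi q))`_1 = 0.
  by apply: P_linear; apply/phiP; exists q.
have [psi psiE] := @tangent_line m phi 3 isT chi1.
have [/phiP[a aE] /phiP[b bE]] := (PA, PB).
have [/phiP[z zE] /phiP[g gE]] := (PZ, PG).
have {rel} : psi b ^+ 3 = - psi a ^+ 4 + psi z ^+ 3 * psi g.
  rewrite -!rmorphXn -rmorphN -rmorphM -rmorphD; congr (psi _); apply: phi_inj.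
  by rewrite [LHS]rmorphXn [RHS]rmorphD [X in X + _]rmorphN [X in _ + X]rmorphM
     !rmorphXn /= aE bE zE gE.
have [] := psiE a; rewrite aE rA !coefXn /= => a0 a1.
have [] := psiE b; rewrite bE rB !coefN !coefXn /= oppr0 => b0 b1.
have [] := psiE z; rewrite zE restr_Z !coef0 => z0 z1.
have [a' psi_a] := poly_root0 a0; rewrite a1 {}psi_a => a'0.
have [b' ->] := poly_double_root0 b0 b1; have [z' ->] := poly_double_root0 z0 z1.
(* The other two terms have order at least 6, so after division by ['X^4] the value at 0 is
   [a'(0)^4 = 1]. *)
move=> rel; have : 'X^4 * (b' ^+ 3 * 'X^2 + a' ^+ 4 - z' ^+ 3 * psi g * 'X^2) = 0.
  transitivity ((b' * 'X * 'X) ^+ 3 + (a' * 'X) ^+ 4 - (z' * 'X * 'X) ^+ 3 * psi g).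
    by ring.
  by rewrite rel; ring.
move/eqP; rewrite mulf_eq0 expf_eq0 polyX_eq0 andbF /= => /eqP.
move/(congr1 (horner^~ 0)); rewrite !hornerE.
rewrite /= !mulr0 subr0 add0r horner_coef0 a'0 expr1n => /eqP.
by rewrite oner_eq0.
Qed.

End Relations.
End NonPolynomial.

(** * Seminvariants and the relations between them *)

Section Seminvariants.

Section Polynomials.
Variables (R : comPzRingType) (y0 y1 y2 y3 y4 : R).

Definition semi2 := y1 ^+ 2 - (y0 * y2) *+ 2.

Definition semi3 := y1 ^+ 3 - (y0 * y1 * y2) *+ 3 + (y0 ^+ 2 * y3) *+ 3.

(* Up to the factor [4 y0^4], the coefficient of [s^4] in the logarithm of
   [1 + (y1/y0) s + (y2/y0) s^2 + ...]; similarly for [semi2] and [semi3]. *)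
Definition semi4 :=
  (y0 ^+ 3 * y4) *+ 4 - (y0 ^+ 2 * y1 * y3) *+ 4 - (y0 ^+ 2 * y2 ^+ 2) *+ 2 +
  (y0 * y1 ^+ 2 * y2) *+ 4 - y1 ^+ 4.

Lemma semi23_rel : exists G, semi3 ^+ 2 = semi2 ^+ 3 + y0 ^+ 2 * G.
Proof.
(* The exact quotient of [semi3 ^+ 2 - semi2 ^+ 3] by [y0 ^+ 2]. *)
exists (- (y1 ^+ 2 * y2 ^+ 2) *+ 3 + (y1 ^+ 3 * y3) *+ 6
  - (y0 * y1 * y2 * y3) *+ 18 + (y0 * y2 ^+ 3) *+ 8 + (y0 ^+ 2 * y3 ^+ 2) *+ 9).
rewrite /semi2 /semi3; ring.
Qed.

Lemma semi34_rel : exists G, semi4 ^+ 3 = - semi3 ^+ 4 + y0 ^+ 3 * G.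
Proof.
(* The exact quotient of [semi4 ^+ 3 + semi3 ^+ 4] by [y0 ^+ 3], ordered by powers of [y0]. *)
exists (4%:R * y1 ^+ 6 * y2 ^+ 3
  - 12%:R * y1 ^+ 7 * y2 * y3
  + 12%:R * y1 ^+ 8 * y4
  - 27%:R * y0 * y1 ^+ 4 * y2 ^+ 4
  + 84%:R * y0 * y1 ^+ 5 * y2 ^+ 2 * y3
  + 6%:R * y0 * y1 ^+ 6 * y3 ^+ 2
  - 96%:R * y0 * y1 ^+ 6 * y2 * y4
  + 48%:R * y0 ^+ 2 * y1 ^+ 2 * y2 ^+ 5
  - 132%:R * y0 ^+ 2 * y1 ^+ 3 * y2 ^+ 3 * y3
  - 132%:R * y0 ^+ 2 * y1 ^+ 4 * y2 * y3 ^+ 2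
  + 240%:R * y0 ^+ 2 * y1 ^+ 4 * y2 ^+ 2 * y4
  + 96%:R * y0 ^+ 2 * y1 ^+ 5 * y3 * y4
  - 8%:R * y0 ^+ 3 * y2 ^+ 6
  - 48%:R * y0 ^+ 3 * y1 * y2 ^+ 4 * y3
  + 390%:R * y0 ^+ 3 * y1 ^+ 2 * y2 ^+ 2 * y3 ^+ 2
  - 192%:R * y0 ^+ 3 * y1 ^+ 2 * y2 ^+ 3 * y4
  + 44%:R * y0 ^+ 3 * y1 ^+ 3 * y3 ^+ 3
  - 384%:R * y0 ^+ 3 * y1 ^+ 3 * y2 * y3 * y4
  - 48%:R * y0 ^+ 3 * y1 ^+ 4 * y4 ^+ 2
  + 48%:R * y0 ^+ 4 * y2 ^+ 4 * y4
  - 324%:R * y0 ^+ 4 * y1 * y2 * y3 ^+ 3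
  + 192%:R * y0 ^+ 4 * y1 * y2 ^+ 2 * y3 * y4
  + 192%:R * y0 ^+ 4 * y1 ^+ 2 * y3 ^+ 2 * y4
  + 192%:R * y0 ^+ 4 * y1 ^+ 2 * y2 * y4 ^+ 2
  + 81%:R * y0 ^+ 5 * y3 ^+ 4
  - 96%:R * y0 ^+ 5 * y2 ^+ 2 * y4 ^+ 2
  - 192%:R * y0 ^+ 5 * y1 * y3 * y4 ^+ 2
  + 64%:R * y0 ^+ 6 * y4 ^+ 3).
rewrite /semi3 /semi4; ring.
Qed.

End Polynomials.

Variables (k : fieldType) (d : nat) (c : 'I_d -> 'I_d -> 'I_d -> k).
Local Notation S := {mpoly k[d]}.
Implicit Types p q : S.

Lemma bracket_invB p q :
  bracket_inv c p -> bracket_inv c q -> bracket_inv c (p - q).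
Proof. by move=> ip iq i; rewrite linearB /= ip iq subr0. Qed.

Lemma bracket_invXn p n : bracket_inv c p -> bracket_inv c (p ^+ n).
Proof. by move=> ip i; rewrite mderXn ip mulr0. Qed.

Lemma bracket_inv_divXn z p n : z != 0 ->
  bracket_inv c z -> bracket_inv c (z ^+ n * p) -> bracket_inv c p.
Proof.
move=> z_neq0 iz izp i; apply: (mulfI (expf_neq0 n z_neq0)).
by have := izp i; rewrite mderM (bracket_invXn _ iz) mul0r add0r mulr0.
Qed.

Fact mderMn (v : 'I_d -> S) p n : mder v (p *+ n) = mder v p *+ n.
Proof. exact: raddfMn. Qed.

Fact mderD (v : 'I_d -> S) p q : mder v (p + q) = mder v p + mder v q.
Proof. exact: raddfD. Qed.

Fact mderB (v : 'I_d -> S) p q : mder v (p - q) = mder v p - mder v q.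
Proof. exact: raddfB. Qed.

Definition mderE := (mderB, mderD, mderMn, mderM, mderXn).

(** For [Y = y0 + y1 s + y2 s^2 + y3 s^3], the derivations satisfy [D Y = a s Y] up to order 3, so
    [D log(Y/y0) = a s] and the coefficients of [s^2] and [s^3] in the logarithm are invariant. *)
Lemma not_polynomial_chain4 (y0 y1 y2 y3 i0 : 'I_d) (a : 'I_d -> k) :
  y0 != y1 -> y2 != y1 -> y3 != y1 ->
  (forall j, c i0 j y0 = (j == y1)%:R) ->
  (forall i, bracket_var c i y0 = 0) ->
  (forall i, bracket_var c i y1 = a i *: 'X_y0) ->
  (forall i, bracket_var c i y2 = a i *: 'X_y1) ->
  (forall i, bracket_var c i y3 = a i *: 'X_y2) ->
  ~ polynomial_subalgebra (bracket_inv c).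
Proof.
move=> n01 n21 n31 ci0 D0 D1 D2 D3.
have i0' : bracket_inv c 'X_y0 by move=> i; rewrite mderX D0.
have i2 : bracket_inv c (semi2 'X_y0 'X_y1 'X_y2).
  by move=> i; rewrite /semi2 !mderE !mderX D0 D1 D2 -!mul_mpolyC; ring.
have i3 : bracket_inv c (semi3 'X_y0 'X_y1 'X_y2 'X_y3).
  by move=> i; rewrite /semi3 !mderE !mderX D0 D1 D2 D3 -!mul_mpolyC; ring.
have [G rel] := semi23_rel ('X_y0 : S) 'X_y1 'X_y2 'X_y3.
have X_neq0 : 'X_y0 != 0 :> S by rewrite -msize_poly_eq0 msizeX.
have iG : bracket_inv c G.
  apply: (@bracket_inv_divXn _ G 2 X_neq0 i0').
  have -> : 'X_y0 ^+ 2 * G = semi3 'X_y0 'X_y1 'X_y2 'X_y3 ^+ 2 -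
      semi2 'X_y0 'X_y1 'X_y2 ^+ 3 by rewrite rel addrC addKr.
  by apply: bracket_invB; apply: bracket_invXn.
apply: (@not_polynomial_23 _ _ y1 _ _ _ _ _ _ i2 i3 i0' iG _ _ _ rel).
- by move=> p; apply: (restr_axis_inv ci0).
- by rewrite restr_axisX (negPf n01).
- rewrite /semi2 rmorphB rmorphMn rmorphXn rmorphM /= !restr_axisX.
  by rewrite eqxx (negPf n01) mul0r mul0rn subr0.
rewrite /semi3 rmorphD rmorphB !rmorphMn !(rmorphXn, rmorphM) /= !restr_axisX.
by rewrite eqxx (negPf n01) (negPf n21); ring.
Qed.

(** Here [D Y = (a s + b s^2) Y] up to order 4. The coefficient of [s^2] in [log(Y/y0)] is in
    general no longer invariant, so those of [s^3] and [s^4] are used. *)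
Lemma not_polynomial_chain5 (y0 y1 y2 y3 y4 i0 : 'I_d) (a b : 'I_d -> k) :
  y0 != y1 -> y2 != y1 -> y3 != y1 -> y4 != y1 ->
  (forall j, c i0 j y0 = (j == y1)%:R) ->
  (forall i, bracket_var c i y0 = 0) ->
  (forall i, bracket_var c i y1 = a i *: 'X_y0) ->
  (forall i, bracket_var c i y2 = a i *: 'X_y1 + b i *: 'X_y0) ->
  (forall i, bracket_var c i y3 = a i *: 'X_y2 + b i *: 'X_y1) ->
  (forall i, bracket_var c i y4 = a i *: 'X_y3 + b i *: 'X_y2) ->
  ~ polynomial_subalgebra (bracket_inv c).
Proof.
move=> n01 n21 n31 n41 ci0 D0 D1 D2 D3 D4.
have i0' : bracket_inv c 'X_y0 by move=> i; rewrite mderX D0.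
have i3 : bracket_inv c (semi3 'X_y0 'X_y1 'X_y2 'X_y3).
  by move=> i; rewrite /semi3 !mderE !mderX D0 D1 D2 D3 -!mul_mpolyC; ring.
have i4 : bracket_inv c (semi4 'X_y0 'X_y1 'X_y2 'X_y3 'X_y4).
  by move=> i; rewrite /semi4 !mderE !mderX D0 D1 D2 D3 D4 -!mul_mpolyC; ring.
have [G rel] := semi34_rel ('X_y0 : S) 'X_y1 'X_y2 'X_y3 'X_y4.
have X_neq0 : 'X_y0 != 0 :> S by rewrite -msize_poly_eq0 msizeX.
have iG : bracket_inv c G.
  apply: (@bracket_inv_divXn _ G 3 X_neq0 i0').
  have -> : 'X_y0 ^+ 3 * G = semi4 'X_y0 'X_y1 'X_y2 'X_y3 'X_y4 ^+ 3 -
      (0 - semi3 'X_y0 'X_y1 'X_y2 'X_y3 ^+ 4) by rewrite rel sub0r addrC addKr.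
  do 2?[apply: bracket_invB]; try exact: bracket_invXn.
  by move=> i; rewrite linear0.
apply: (@not_polynomial_34 _ _ y1 _ _ _ _ _ _ i3 i4 i0' iG _ _ _ rel).
- by move=> p; apply: (restr_axis_inv ci0).
- by rewrite restr_axisX (negPf n01).
- rewrite /semi3 rmorphD rmorphB !rmorphMn !(rmorphXn, rmorphM) /= !restr_axisX.
  by rewrite eqxx (negPf n01) (negPf n21); ring.
rewrite /semi4 rmorphB rmorphD !rmorphB !rmorphMn !(rmorphXn, rmorphM) /= !restr_axisX.
by rewrite eqxx (negPf n01) (negPf n21) (negPf n31) (negPf n41); ring.
Qed.

End Seminvariants.

(** * Lie algebras given by a multiplication table *)

Section Tables.
Variables (k : fieldType) (g : lieAlgType k).
Local Notation n := (\dim {:g}).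

Lemma lieb_anti (x y : g) : lieb x y = - lieb y x.
Proof.
apply/eqP; rewrite -addr_eq0; apply/eqP.
have := liebb (x + y); rewrite -{1}[x]scale1r lieb_linearl scale1r.
rewrite ![lieb _ (x + y)]linearD /= !liebb add0r addr0.
by [].
Qed.

Variable X : n.-tuple g.
Hypothesis bX : basis_of {:g} X.

Lemma coord_basis_nth (l : 'I_n) (m : nat) :
  (m < n)%N -> coord X l X`_m = (m == l)%:R.
Proof.
by move=> lt_mn; rewrite (coord_free (Ordinal lt_mn)) ?(basis_free bX).
Qed.

Lemma struct_const_anti i j l : struct_const X i j l = - struct_const X j i l.
Proof. by rewrite /struct_const lieb_anti linearN. Qed.

Lemma bracket_var_comb (i j l m : 'I_n) a b :
  lieb X`_i X`_j = a *: X`_l + b *: X`_m ->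
  bracket_var (struct_const X) i j = a *: 'X_l + b *: 'X_m.
Proof.
move=> E; rewrite /bracket_var /struct_const E.
under eq_bigr do rewrite linearD !linearZ /= !coord_basis_nth // scalerDl.
rewrite big_split (bigD1 l) //= eqxx big1 => [|i']; last first.
  by rewrite -val_eqE eq_sym => /negPf /= ->; rewrite mulr0 scale0r.
rewrite (bigD1 m) //= eqxx big1 => [|i']; last first.
  by rewrite -val_eqE eq_sym => /negPf /= ->; rewrite mulr0 scale0r.
by rewrite !mulr1 !addr0.
Qed.

(** The basis vectors after the first [r] span an abelian subspace, which the first [r]
    complement. *)
Lemma lie_index_ge_drop r :
  (forall i j, (r <= i)%N -> (i < j)%N -> (j < n)%N -> lieb X`_i X`_j = 0) ->
  (r <= n)%N -> (n - r - r <= lie_index g)%N.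
Proof.
move=> abX le_rn; pose U := <<drop r X>>%VS.
have dimU : \dim U = (n - r)%N.
  have /catr_free/eqP : free (take r X ++ drop r X).
    by rewrite cat_take_drop (basis_free bX).
  by rewrite size_drop size_tuple.
have {2}-> : r = size (take r X) by rewrite size_take size_tuple; case: ltngtP le_rn.
rewrite -dimU; apply: lie_index_ge; last first.
  rewrite addvC -span_cat cat_take_drop; exact: span_basis.
have abXX i j : (r <= i < n)%N -> (r <= j < n)%N -> lieb X`_i X`_j = 0.
  case: (ltngtP i j) => [lt_ij|lt_ji|->] /andP[ri iN] /andP[rj jN].
  - exact: abX.
  - by rewrite lieb_anti abX ?oppr0.
  exact: liebb.
move=> x y xU yU; rewrite (coord_span (X := in_tuple (drop r X)) yU).
rewrite (linear_sum (lieb x)) big1 // => j _; rewrite linearZ /= lieb_anti.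
rewrite (coord_span (X := in_tuple (drop r X)) xU).
rewrite (linear_sum (lieb _)) big1 ?oppr0 ?scaler0 // => i _; rewrite linearZ /=.
have bnd (i' : 'I_(size (drop r X))) : (r <= r + i' < n)%N.
  by rewrite leq_addr /= -ltn_subRL -[n in (n - _)%N](size_tuple X) -size_drop.
by rewrite !nth_drop abXX ?scaler0 ?bnd.
Qed.

Section GradedTable.
Variables (t : nat -> nat -> k) (s : nat -> nat -> nat).
Hypothesis tableX : forall i j, (1 <= i)%N -> (i < j)%N -> (j <= n)%N ->
  lieb X`_i.-1 X`_j.-1 = t i j *: X`_(s i j).-1.
Variables (e : nat -> nat) (N u : nat).
Hypothesis char0 : [pchar k] =i pred0.
Hypotheses (u_gt0 : (1 <= u)%N) (lt_un : (u < n)%N) (en : e n = 0%N).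
Hypothesis e_gt0 : forall i, (1 <= i)%N -> (i < n)%N -> (0 < e i)%N.
Hypothesis e_inj : forall i j, (1 <= i <= n)%N -> (1 <= j <= n)%N ->
  e i = e j -> i = j.
Hypothesis t_grading : forall i j, (1 <= i)%N -> (i < j)%N -> (j <= n)%N ->
  t i j != 0 ->
  [/\ (j < n)%N, (1 <= s i j <= n)%N & (e i + e j = N + e (s i j))%N].
Hypothesis pairing : forall a, (1 <= a)%N -> (a < n)%N -> a != u ->
  exists a', (1 <= a' <= n)%N /\
   ((a' < a)%N /\ t a' a != 0 /\ s a' a = n \/
    (a < a')%N /\ t a a' != 0 /\ s a a' = n).

Lemma struct_const_table (i j l : 'I_n) : (i < j)%N ->
  struct_const X i j l = t i.+1 j.+1 *+ (s i.+1 j.+1 == l.+1).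
Proof.
move=> lt_ij; rewrite /struct_const.
have -> : lieb X`_i X`_j = t i.+1 j.+1 *: X`_(s i.+1 j.+1).-1.
  exact: (@tableX i.+1 j.+1).
rewrite linearZ /=; have [-> | t_neq0] := eqVneq (t i.+1 j.+1) 0.
  by rewrite mul0r mul0rn.
have [_ /andP[s1 sn] _] := @t_grading i.+1 j.+1 isT lt_ij (ltn_ord j) t_neq0.
by rewrite coord_basis_nth ?prednK // mulr_natr -{2}(prednK s1) eqSS.
Qed.

(** The coordinate along [x_n] is a form whose radical lies in the span of [x_u] and [x_n], which
    bounds the index; the same pairing feeds [graded_polynomial_inv]. *)
Lemma graded_table_coregular : (lie_index g <= 2)%N /\ coregular g.
Proof.
have n_gt0 : (0 < n)%N by lia.
have lt_u1 : (u.-1 < n)%N by lia.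
have lt_n1 : (n.-1 < n)%N by lia.
pose uo := Ordinal lt_u1; pose z := Ordinal lt_n1.
have valE (i j : 'I_n) : (i == j) = (i.+1 == j.+1) by rewrite eqSS.
have neq_uz : uo != z by rewrite valE /= !prednK //; lia.
pose e' (i : 'I_n) := e i.+1.
have ez : e' z = 0%N by rewrite /e' /= prednK.
have e'_gt0 i : i != z -> (0 < e' i)%N.
  rewrite valE /= prednK // => ne_in; apply: e_gt0 => //.
  by have := ltn_ord i; move: ne_in; lia.
have e'_inj : injective e'.
  move=> i j /e_inj E; apply/val_inj/eqP; rewrite -eqSS /=; apply/eqP/E.
    by rewrite ltn_ord.
  by rewrite ltn_ord.
have struct_grading_lt (i j l : 'I_n) : (i < j)%N -> struct_const X i j l != 0 ->
    (j.+1 < n)%N /\ (e' i + e' j = N + e' l)%N.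
  move=> lt_ij; rewrite struct_const_table //.
  case: (s _ _ =P l.+1) => [sl t_neq0|_]; last by rewrite eqxx.
  have [ltj _ eE] := @t_grading i.+1 j.+1 isT lt_ij (ltn_ord j) t_neq0.
  by rewrite /e' eE sl.
have struct_grading (i j l : 'I_n) : struct_const X i j l != 0 ->
    (e' i + e' j = N + e' l)%N.
  case: (ltngtP i j) => [lt_ij /(struct_grading_lt _ _ _ lt_ij)[]//|lt_ji|/val_inj ->].
    rewrite struct_const_anti oppr_eq0 => /(struct_grading_lt _ _ _ lt_ji)[_ <-].
    by rewrite addnC.
  by rewrite /struct_const liebb linear0 eqxx.
have z_central i l : struct_const X i z l = 0.
  apply/eqP; apply: contraT; case: (ltngtP i z) => [lt_iz|lt_zi|/val_inj ->].
  - by move=> /(struct_grading_lt _ _ _ lt_iz)[]; rewrite /= prednK // ltnn.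
  - by move: lt_zi; rewrite /= ltnNge -ltnS prednK // ltn_ord.
  by rewrite /struct_const liebb linear0 eqxx.
have z_pairing a : a != uo -> a != z -> exists a', struct_const X a' a z != 0.
  rewrite !valE /= !prednK // => ne_au ne_an.
  have lt_an : (a.+1 < n)%N by have := ltn_ord a; move: ne_an; lia.
  have [b [/andP[b1 bn] ]] := @pairing a.+1 isT lt_an ne_au.
  have lt_bn : (b.-1 < n)%N by rewrite prednK.
  move=> H; exists (Ordinal lt_bn).
  have bE : (Ordinal lt_bn).+1 = b by rewrite /= prednK.
  have zE : z.+1 = n by rewrite /= prednK.
  case: H => [[lt_ba [tba sba]]|[lt_ab [tab sab]]].
    by rewrite struct_const_table -1?ltnS bE // zE sba eqxx.
  by rewrite struct_const_anti oppr_eq0 struct_const_table -1?ltnS bE // zE sab eqxx.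
split; last first.
  apply/(coregular_basis bX).
  exact: (graded_polynomial_inv char0 neq_uz ez e'_gt0 e'_inj struct_grading).
have lin_z : linear (coord X z : g -> k^o) by move=> a x y; rewrite linearP.
pose L : {linear g -> k^o} := HB.pack (coord X z : g -> k^o)
  (GRing.isLinear.Build k g k^o _ _ lin_z).
pose xi : 'Hom(g, k^o) := linfun L.
have xiE x : xi x = coord X z x by rewrite lfunE.
apply: (leq_trans (lie_index_le xi)).
apply: (@leq_trans (\dim <<[:: X`_uo; X`_z]>>)%VS); last exact: dim_span.
apply/dimvS/subvP => x /mem_lie_radical xP.
(* By the grading and the injectivity of the weights, [X_b] pairs with [X_a] alone. *)
have x0 a : a != uo -> a != z -> coord X a x = 0.
  move=> ne_au ne_az; have [b cb] := z_pairing a ne_au ne_az.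
  have := xP X`_b; rewrite xiE lieb_anti linearN /= => /eqP.
  rewrite oppr_eq0 [x in lieb _ x](coord_basis bX (memvf x)).
  rewrite (linear_sum (lieb _)) linear_sum (bigD1 a) //= big1 => [|i ne_ia].
    rewrite !linearZ addr0 /= mulf_eq0 => /orP[/eqP//|cb0].
    by rewrite -[coord _ _ _]/(struct_const X b a z) (negPf cb) in cb0.
  rewrite !linearZ /= -[coord _ _ (lieb _ _)]/(struct_const X b i z).
  have [->|/struct_grading E] := eqVneq (struct_const X b i z) 0; first exact: mulr0.
  have /e'_inj E' : e' i = e' a.
    by have := struct_grading _ _ _ cb; move: E; lia.
  by rewrite E' eqxx in ne_ia.
rewrite (coord_basis bX (memvf x)); apply: memv_suml => i _.
have [->|ne_iu] := eqVneq i uo; first by rewrite memvZ // memv_span ?mem_head.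
have [->|ne_iz] := eqVneq i z.
  by rewrite memvZ // memv_span // !inE eqxx orbT.
by rewrite x0 // scale0r mem0v.
Qed.

End GradedTable.
End Tables.

(** * The four types of filiform algebras *)

Section Types.
Variables (k : fieldType) (char0 : [pchar k] =i pred0) (g : lieAlgType k).
Local Notation n := (\dim {:g}).

(** In dimension at most 1 all brackets vanish and every polynomial is invariant; the graded
    argument needs two distinct basis vectors [x_u] and [x_n]. *)
Lemma dim_le1_coregular : (n <= 1)%N -> (lie_index g <= 2)%N /\ coregular g.
Proof.
move=> n_le1; split.
  apply: leq_trans (lie_index_le 0) (leq_trans (dimvS (subvf _)) _).
  exact: leq_trans n_le1 _.
exists n, idfun; split=> // p; split=> [_|_]; first by exists p.
move=> x; rewrite /symalg_ad big1 // => i _.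
rewrite {1}(coord_vbasis (memvf x)).
have -> : lieb (\sum_j coord (vbasis {:g}) j x *: (vbasis {:g})`_j) (vbasis {:g})`_i = 0.
  rewrite lieb_anti (linear_sum (lieb _)) big1 ?oppr0 // => j _.
  rewrite linearZ /= (_ : j = i) ?liebb ?scaler0 //.
  by apply/val_inj; have := ltn_ord i; have := ltn_ord j; move: n_le1 => /=; lia.
by rewrite [symalg_in 0]linear0 mulr0.
Qed.

Lemma typeW_coregular : typeW g n -> (lie_index g <= 2)%N /\ coregular g.
Proof.
case: (leqP n 1) => [/dim_le1_coregular//|n_ge2] [X [bX tableX]].
pose t i j : k := if (i + j <= n)%N then (j - i)%N%:R else 0.
(* [x_a] pairs with [x_(n-a)], so for even [n] the middle vector is left over. For odd [n] all
   vectors before [x_n] are paired and [u] may be chosen freely. *)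
pose u := if odd n then 1%N else n./2.
have uE : (1 <= u)%N /\ (u < n)%N /\ (odd n \/ n = u.*2).
  by rewrite /u; case: (boolP (odd n)) => on; have := odd_double_half n; lia.
case: uE => u1 [un uN].
(* The weight [n - i] vanishes at [x_n]; as brackets add indices, the shift [N] is [n]. *)
apply: (@graded_table_coregular _ _ X bX t addn _ (fun i => n - i)%N n u) => //.
- move=> i j i1 ij jn; rewrite tableX // /t.
  by case: ifP => // _; rewrite scale0r.
- by rewrite subnn.
- by move=> i _; rewrite subn_gt0.
- by move=> i j; lia.
- move=> i j i1 ij jn; rewrite /t; case: ifP => [ijn _|_]; last by rewrite eqxx.
  by split; lia.
move=> a a1 an ne_au; exists (n - a)%N; split; first by lia.
have ne : a != (n - a)%N by case: uN ne_au => [on _|nE]; lia.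
have t_neq0 i j : (i < j)%N -> (i + j <= n)%N -> t i j != 0.
  move=> ij ijn; rewrite /t ijn (natr_eq0_char0 char0) -lt0n; lia.
case: (ltngtP (n - a)%N a) => [lt|lt|E]; last by rewrite E eqxx in ne.
  by left; split=> //; split; [apply: t_neq0 => //; lia | lia].
by right; split=> //; split; [apply: t_neq0 => //; lia | lia].
Qed.

Lemma typeQ_coregular : typeQ g n -> (lie_index g <= 2)%N /\ coregular g.
Proof.
case: (leqP n 1) => [/dim_le1_coregular//|n_ge2] [even_n [X [bX tableX]]].
pose t i j : k := if (i == 1)%N && (2 <= j <= n - 2)%N then 1
  else if (2 <= i <= n./2)%N && (j == n - i + 1)%N then (-1) ^+ i.+1 else 0.
pose s i j := if i == 1%N then j.+1 else n.
have nE := odd_double_half n; rewrite (negPf even_n) add0n in nE.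
(* The weight drops from 2 at [x_(n-1)] to 0 at [x_n]: this makes the pairing of [x_j] with
   [x_(n-j+1)] homogeneous with the same shift [n.+1] as the chain under [x_1]. As [x_1] never
   brackets to [x_n], it is the unpaired vector. *)
pose e i := if i == n then 0%N else (n.+1 - i)%N.
apply: (@graded_table_coregular _ _ X bX t s _ e n.+1 1%N) => //.
- move=> i j i1 ij jn; rewrite tableX // /t /s.
  case: (eqVneq i 1%N) => [->|_] /=; last by case: ifP; rewrite ?scale0r.
  by case: ifP; rewrite ?scale1r ?scale0r.
- by rewrite /e eqxx.
- by move=> i i1 lt_in; rewrite /e (ltn_eqF lt_in); lia.
- move=> i j ib jb; rewrite /e.
  by case: (eqVneq i n) => [->|]; case: (eqVneq j n) => [->|]; lia.
- move=> i j i1 ij jn; rewrite /t /s /e.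
  case: (eqVneq i 1%N) => [->|ne_i1] /=.
    case: ifP => [jb _|_]; last by rewrite eqxx.
    by do !(case: eqP => ?); split; lia.
  case: (boolP ((1 < i <= n./2)%N && _)) => [/andP[ib /eqP jE] _|_]; last by case/eqP.
  by rewrite eqxx; do !(case: eqP => ?); split; lia.
move=> a a1 an ne_a1; exists (n - a + 1)%N; split; first by lia.
have sgn_neq0 m : (-1) ^+ m != 0 :> k by rewrite expf_neq0 // oppr_eq0 oner_eq0.
have t_neq0 i j : (2 <= i)%N -> (i < j)%N -> j = (n - i + 1)%N -> t i j != 0.
  move=> i2 ij jE; rewrite /t; case: ifP => [|_]; first by lia.
  by rewrite jE eqxx; case: ifP => // /negP[]; lia.
case: (ltngtP (n - a + 1)%N a) => [lt|lt|E]; last by lia.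
  left; split=> //; split; first by apply: t_neq0; lia.
  by rewrite /s; case: eqP => //; lia.
right; split=> //; split; first by apply: t_neq0; lia.
by rewrite /s; case: eqP => //; lia.
Qed.

Lemma typeL_small_coregular :
  (n <= 4)%N -> typeL g n -> (lie_index g <= 2)%N /\ coregular g.
Proof.
move=> n_le4 [n_ge3 [X [bX tableX]]].
pose t i j : k := if (i == 1)%N && (2 <= j <= n - 1)%N then 1 else 0.
(* [x_1] pairs with [x_(n-1)]. For [n = 4] this leaves [x_2]; for [n = 3] nothing is left and [x_1]
   serves as [x_u]. *)
apply: (@graded_table_coregular _ _ X bX t addn _ (fun i => n - i)%N n (n - 2)%N) => //.
- move=> i j i1 ij jn; rewrite tableX // /t.
  by case: ifP => [/andP[/eqP-> _]|_]; rewrite ?scale1r ?scale0r.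
- by lia.
- by lia.
- by rewrite subnn.
- by move=> i _; rewrite subn_gt0.
- by move=> i j; lia.
- move=> i j i1 ij jn; rewrite /t; case: ifP => [ijn _|_]; last by rewrite eqxx.
  by split; lia.
move=> a a1 an ne_au; exists (n - a)%N; split; first by lia.
have t_neq0 j : (2 <= j <= n - 1)%N -> t 1%N j != 0.
  by rewrite /t => ->; apply: oner_neq0.
case: (eqVneq a 1%N) => [a1E|ne_a1].
  by right; rewrite a1E; split; [lia | split; [apply: t_neq0; lia | lia]].
left; have E : (n - a = 1)%N by lia.
by rewrite E; split; [lia | split; [apply: t_neq0; lia | lia]].
Qed.

Lemma typeR_small_coregular :
  (n <= 6)%N -> typeR g n -> (lie_index g <= 2)%N /\ coregular g.
Proof.
move=> n_le6 [n_ge5 [X [bX tableX]]].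
pose t i j : k := if (i == 1)%N && (2 <= j <= n - 1)%N then 1
  else if (i == 2)%N && (3 <= j <= n - 2)%N then 1 else 0.
(* The pairs are [x_1, x_(n-1)] and [x_2, x_(n-2)]; they leave [x_3] for [n = 6] and nothing for
   [n = 5]. *)
pose u := if n == 6%N then 3%N else 1%N.
apply: (@graded_table_coregular _ _ X bX t addn _ (fun i => n - i)%N n u) => //.
- move=> i j i1 ij jn; rewrite tableX // /t.
  case: ifP => [/andP[/eqP-> _]|_]; first by rewrite scale1r.
  by case: ifP => [/andP[/eqP-> _]|_]; rewrite ?scale1r ?scale0r.
- by rewrite /u; case: ifP.
- by rewrite /u; case: eqP; lia.
- by rewrite subnn.
- by move=> i _; rewrite subn_gt0.
- by move=> i j; lia.
- move=> i j i1 ij jn; rewrite /t; case: ifP => [ijn _|_]; first by split; lia.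
  by case: ifP => [ijn _|_]; [split; lia | rewrite eqxx].
move=> a a1 an ne_au; exists (n - a)%N; split; first by lia.
have t1 j : (2 <= j <= n - 1)%N -> t 1%N j != 0.
  by rewrite /t => ->; apply: oner_neq0.
have t2 j : (3 <= j <= n - 2)%N -> t 2%N j != 0.
  by rewrite /t => ->; apply: oner_neq0.
have : a = 1%N \/ a = 2%N \/ (n - a = 1)%N \/ (n - a = 2)%N.
  by move: ne_au; rewrite /u; case: (eqVneq n 6%N) => [nE|nE]; lia.
case=> [->|[->|[E|E]]].
- by right; split; [lia | split; [apply: t1; lia | lia]].
- by right; split; [lia | split; [apply: t2; lia | lia]].
- by left; rewrite E; split; [lia | split; [apply: t1; lia | lia]].
case: (leqP a 2) => [a2|a3].
  have -> : a = 2%N by lia.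
  by right; split; [lia | split; [apply: t2; lia | lia]].
by left; rewrite E; split; [lia | split; [apply: t2; lia | lia]].
Qed.

Lemma typeL_large : (5 <= n)%N -> typeL g n -> (2 < lie_index g)%N /\ ~ coregular g.
Proof.
move=> n_ge5 [_ [X [bX tableX]]].
have table i j : (i < j)%N -> (j < n)%N -> lieb X`_i X`_j =
    if (i == 0)%N && (1 <= j < n.-1)%N then X`_j.+1 else 0.
  move=> ij jn; rewrite (tableX i.+1 j.+1) //=.
  have -> : (2 <= j.+1 <= n - 1)%N = (1 <= j < n.-1)%N by lia.
  by [].
split.
  (* Without [x_1] the basis is abelian, so the index is at least [n - 2 >= 3]. *)
  apply: leq_trans (@lie_index_ge_drop _ _ X bX 1 _ _); [lia| |lia].
  by move=> i j i1 ij jn; rewrite table //; case: eqP => //; lia.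
have lt m : (1 <= m)%N -> (n - m < n)%N by lia.
(* Positions start at 0, so [y m] stands for [x_(n-m+1)], and [y 1] is the central vector [x_n]. *)
pose y m (m1 : (1 <= m)%N) := Ordinal (lt m m1).
pose i0 := Ordinal (leq_trans (isT : (0 < 5)%N) n_ge5).
have bv (i j : 'I_n) : (1 <= j)%N -> lieb X`_i X`_j =
    if (i == i0)%N && (j < n.-1)%N then X`_j.+1 else 0.
  move=> j1; rewrite -val_eqE /=; case: (ltngtP i j) => [ij|ji|E].
  - by rewrite table // j1.
  - by rewrite lieb_anti table //; do !case: eqP => //=; rewrite ?oppr0 //; lia.
  by rewrite E liebb; case: eqP => //=; lia.
pose a (i : 'I_n) : k := (i == i0)%:R.
have chain m (m1 : (1 <= m)%N) : (m.+1 < n)%N -> forall i,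
    bracket_var (struct_const X) i (y m.+1 isT) = a i *: 'X_(y m m1).
  move=> mn i; rewrite -[RHS]addr0 -[in RHS](scale0r 'X_(y m m1)).
  apply: (bracket_var_comb bX); rewrite scale0r addr0 bv /=; last by lia.
  have -> : (n - m.+1 < n.-1)%N by lia.
  have -> : (n - m.+1).+1 = (n - m)%N by lia.
  by rewrite /a andbT; case: eqP; rewrite ?scale1r ?scale0r.
move/(coregular_basis bX).
have ne m m' m1 m1' : (m <= n)%N -> (m' <= n)%N -> m != m' -> y m m1 != y m' m1'.
  by move=> mn mn' mm'; rewrite -val_eqE /=; lia.
(* As [n >= 5], the chain from [x_n] down to [x_(n-3)] avoids [x_1], which acts on it by the
   shift. *)
apply: (@not_polynomial_chain4 _ _ _ (y 1 isT) (y 2 isT) (y 3 isT) (y 4 isT) i0 a).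
- by apply: ne; lia.
- by apply: ne; lia.
- by apply: ne; lia.
- move=> j; rewrite /struct_const -val_eqE /=; case: (posnP j) => [j0|j1].
    have -> : X`_i0 = X`_j by rewrite j0.
    by rewrite liebb linear0 j0; case: eqP => //; lia.
  rewrite table //= j1 /=; case: ifP => jn; last first.
    by rewrite linear0; case: eqP => //; have := ltn_ord j; lia.
  by rewrite coord_basis_nth //=; [congr (_%:R); case: eqP; case: eqP => //; lia | lia].
- move=> i; rewrite /bracket_var /struct_const big1 // => l _.
  rewrite bv /=; last by lia.
  have -> : (n - 1 < n.-1)%N = false by lia.
  by rewrite andbF linear0 scale0r.
- by apply: chain; lia.
- by apply: chain; lia.
- by apply: chain; lia.
Qed.

Lemma typeR_large : (7 <= n)%N -> typeR g n -> (2 < lie_index g)%N /\ ~ coregular g.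
Proof.
move=> n_ge7 [_ [X [bX tableX]]].
have table i j : (i < j)%N -> (j < n)%N -> lieb X`_i X`_j =
    if (i == 0)%N && (1 <= j < n.-1)%N then X`_j.+1
    else if (i == 1)%N && (2 <= j < n.-2)%N then X`_j.+2 else 0.
  move=> ij jn; rewrite (tableX i.+1 j.+1) //=.
  have -> : (2 <= j.+1 <= n - 1)%N = (1 <= j < n.-1)%N by lia.
  by have -> : (3 <= j.+1 <= n - 2)%N = (2 <= j < n.-2)%N by lia.
split.
  (* Without [x_1] and [x_2] the basis is abelian, so the index is at least [n - 4 >= 3]. *)
  apply: leq_trans (@lie_index_ge_drop _ _ X bX 2 _ _); [lia| |lia].
  by move=> i j i1 ij jn; rewrite table //; do !case: eqP => //=; lia.
have lt m : (1 <= m)%N -> (n - m < n)%N by lia.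
pose y m (m1 : (1 <= m)%N) := Ordinal (lt m m1).
pose i0 := Ordinal (leq_trans (isT : (0 < 7)%N) n_ge7).
pose i1 := Ordinal (leq_trans (isT : (1 < 7)%N) n_ge7).
have bv (i j : 'I_n) : (2 <= j)%N -> lieb X`_i X`_j =
    (if (i == i0)%N && (j < n.-1)%N then X`_j.+1 else 0) +
    (if (i == i1)%N && (j < n.-2)%N then X`_j.+2 else 0).
  move=> j2; rewrite -!val_eqE /=; case: (ltngtP i j) => [ij|ji|E].
  - rewrite table // j2 (ltnW j2) /=.
    by case: (eqVneq (i : nat) 0%N) => [->|_] /=; case: ifP; rewrite ?addr0 ?add0r.
  - by rewrite lieb_anti table //; do !case: eqP => //=; rewrite ?oppr0 ?addr0 //; lia.
  by rewrite E liebb; do !case: eqP => //=; rewrite ?addr0 //; lia.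
pose a (i : 'I_n) : k := (i == i0)%:R.
pose b (i : 'I_n) : k := (i == i1)%:R.
have chain m (m1 : (1 <= m)%N) : (m.+3 < n)%N -> forall i,
    bracket_var (struct_const X) i (y m.+2 isT) =
    a i *: 'X_(y m.+1 isT) + b i *: 'X_(y m m1).
  move=> mn i; apply: (bracket_var_comb bX); rewrite bv /=; last by lia.
  have -> : (n - m.+2 < n.-1)%N by lia.
  have -> : (n - m.+2 < n.-2)%N by lia.
  have -> : (n - m.+2).+1 = (n - m.+1)%N by lia.
  have -> : (n - m.+1).+1 = (n - m)%N by lia.
  by rewrite /a /b !andbT; do !case: eqP; rewrite ?scale1r ?scale0r.
move/(coregular_basis bX).
have ne m m' m1 m1' : (m <= n)%N -> (m' <= n)%N -> m != m' -> y m m1 != y m' m1'.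
  by move=> mn mn' mm'; rewrite -val_eqE /=; lia.
(* As [n >= 7], the chain from [x_n] down to [x_(n-4)] avoids [x_1] and [x_2], which shift it by one
   and two places. *)
apply: (@not_polynomial_chain5 _ _ _ (y 1 isT) (y 2 isT) (y 3 isT) (y 4 isT)
  (y 5 isT) i0 a b).
- by apply: ne; lia.
- by apply: ne; lia.
- by apply: ne; lia.
- by apply: ne; lia.
- move=> j; rewrite /struct_const -val_eqE /=; case: (posnP j) => [j0|j1].
    have -> : X`_i0 = X`_j by rewrite j0.
    by rewrite liebb linear0 j0; case: eqP => //; lia.
  rewrite table //= j1 /=; case: ifP => jn; last first.
    by rewrite linear0; case: eqP => //; have := ltn_ord j; lia.
  by rewrite coord_basis_nth //=; [congr (_%:R); case: eqP; case: eqP => //; lia | lia].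
- move=> i; rewrite /bracket_var /struct_const big1 // => l _.
  rewrite bv /=; last by lia.
  have -> : (n - 1 < n.-1)%N = false by lia.
  have -> : (n - 1 < n.-2)%N = false by lia.
  by rewrite !andbF addr0 linear0 scale0r.
(* On [x_(n-1)] only [x_1] acts, since a shift by two would leave the basis. *)
- move=> i; rewrite -[RHS]addr0 -[in RHS](scale0r 'X_(y 1 isT)).
  apply: (bracket_var_comb bX); rewrite scale0r addr0 bv /=; last by lia.
  have -> : (n - 2 < n.-1)%N by lia.
  have -> : (n - 2 < n.-2)%N = false by lia.
  have -> : (n - 2).+1 = (n - 1)%N by lia.
  by rewrite /a andbT andbF addr0; case: eqP; rewrite ?scale1r ?scale0r.
- by apply: chain; lia.
- by apply: chain; lia.
- by apply: chain; lia.
Qed.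

End Types.

Theorem theorem51 (k : closedFieldType) (char0 : [pchar k] =i pred0)
    (g : lieAlgType k) (n : nat) (dim_g : \dim {:g} = n) (fil_g : filiform g) :
  (typeQ g n \/ typeW g n -> (lie_index g <= 2)%N /\ coregular g) /\
  (typeL g n \/ typeR g n -> (coregular g <-> (lie_index g <= 2)%N)).
Proof.
subst n; split=> [[/(typeQ_coregular char0)|/(typeW_coregular char0)]//|].
(* For [L_n] and [R_n] small index and coregularity hold together up to dimension 4, respectively 6,
   and fail together above. *)
have dichotomy :
    (lie_index g <= 2)%N /\ coregular g \/ (2 < lie_index g)%N /\ ~ coregular g ->
    (coregular g <-> (lie_index g <= 2)%N).
  case=> [[le2 cor]|[lt2 ncor]]; first by split.
  by split=> // le2; rewrite ltnNge le2 in lt2.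
case=> [tL|tR]; apply: dichotomy.
- case: (leqP (\dim {:g}) 4) => [le4|lt4]; last by right; apply: typeL_large.
  by left; apply: typeL_small_coregular.
- case: (leqP (\dim {:g}) 6) => [le6|lt6]; last by right; apply: typeR_large.
  by left; apply: typeR_small_coregular.
Qed.
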